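(* (Symbolic method.) Let $f=\sum_{i=0}^n\binom nix^{n-i}y^iA_i$ be an $n$-form and let $d\in H_I^{Inv}$ be an element of the subalgebra generated by $x_1,y_1,\dots,x_k,y_k$ which is homogeneous of degree $n$ with respect to each of the indices $1,2,\dots,k$. Let $$d=\sum_{i_1,\dots,i_k}c_{i_1,\dots,i_k}A^{(1)}_{i_1}A^{(2)}_{i_2}\cdots A^{(k)}_{i_k},\qquad c_{i_1,\dots,i_k}\in\mathbb C,$$ be the expression of $d$ through the coefficients $A^{(j)}_i$ of the special $n$-forms $(0j)^n=\sum_{i=0}^n\binom nix^{n-i}y^iA^{(j)}_i$, $j=1,\dots,k$. Then $$\mathcal I=\sum_{i_1,\dots,i_k}c_{i_1,\dots,i_k}A_{i_1}A_{i_2}\cdots A_{i_k}$$ is an invariant of $f$ of degree $k$, i.e. a polynomial expression of degree $k$ in the coefficients of $f$ with $\mathcal I\in H_{I\setminus\{0\}}^{Inv}$.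
   Context: Fix $h\in\mathbb C$, $h\neq0$. $U_h(sl(2))$ is the complex unital Hopf algebra with generators $E,F,H$, relations $[H,E]=E\cosh(hF)+\cosh(hF)E$, $[H,F]=-\frac2h\sinh(hF)$, $[E,F]=H$, and coproduct $\Delta(E)=E\otimes e^{-hF}+e^{hF}\otimes E$, $\Delta(F)=F\otimes1+1\otimes F$, $\Delta(H)=H\otimes e^{-hF}+e^{hF}\otimes H$. For a totally ordered index set $I$, $H_I$ is the unital complex algebra with generators $x_i,y_i$ ($i\in I$) and relations $x_iy_i=y_ix_i+hy_i^2$ and, for $i<j$, $x_jy_i=y_ix_j+hy_iy_j$, $y_jx_i=x_iy_j-hy_iy_j$, $y_jy_i=y_iy_j$, $x_jx_i=x_ix_j-hx_iy_j+hy_ix_j+h^2y_iy_j$. It is a $U_h(sl(2))$-module algebra via $Hx_i=x_i$, $Hy_i=-y_i$, $Ex_i=0$, $Ey_i=x_i$, $Fx_i=y_i$, $Fy_i=0$, $E1=F1=H1=0$, and $E(ab)=E(a)e^{-hF}(b)+e^{hF}(a)E(b)$, $F(ab)=F(a)b+aF(b)$, $H(ab)=H(a)e^{-hF}(b)+e^{hF}(a)H(b)$. $H_I^{Inv}$ is the set of $v\in H_I$ with $Ev=Fv=Hv=0$. $(ij)=x_iy_j-y_ix_j-hy_iy_j$. Assume $0,1,\dots,k\in I$ and write $x=x_0$, $y=y_0$; $H_{I\setminus\{0\}}$ is the subalgebra generated by $x_i,y_i$, $i\in I\setminus\{0\}$, and $H_{I\setminus\{0\}}^{Inv}=H_{I\setminus\{0\}}\cap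 H_I^{Inv}$. An $n$-form is a nonzero element $f=\sum_i\binom nix^{n-i}y^iA_i\in H_I^{Inv}$ with $A_i\in H_{I\setminus\{0\}}$ (the $A_i$ are unique). The coefficients of $(0j)^n$ are of the form $A_i^{(j)}=(-1)^ix_j^iy_j^{n-i}+(\text{terms of lower degree in }x_j)$, so that successive elimination of the $x_j^iy_j^{n-i}$, $i=n,n-1,\dots,0$, in the expansion of $d$ in ordered monomials $x_1^{n-i_1}y_1^{i_1}\cdots x_k^{n-i_k}y_k^{i_k}$ yields the displayed expression of $d$ (with uniquely determined $c_{i_1,\dots,i_k}$). The degree-$k$ invariant may turn out to be zero. *)

(* Defs.v *)
From HB Require Import structures.
From mathcomp Require Import all_boot all_order all_algebra.
From mathcomp Require Import ring.
From mathcomp Require Import boolp reals complex.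

Set Implicit Arguments.
Unset Strict Implicit.
Unset Printing Implicit Defensive.

Import Order.TTheory GRing.Theory Num.Theory.
Local Open Scope ring_scope.
Local Open Scope quotient_scope.

Section ModuleAlgebra.
Context (K : numFieldType) (disp : Order.disp_t) (I : orderType disp) (h : K).

Inductive hterm : Type :=
| TX of I
| TY of I
| TC of K
| TA of hterm & hterm
| TM of hterm & hterm.

Local Notation "a +t b" := (TA a b) (at level 50, left associativity).
Local Notation "a *t b" := (TM a b) (at level 40, left associativity).

Inductive hrel : hterm -> hterm -> Prop :=
| rel_xy i : hrel (TX i *t TY i) (TY i *t TX i +t TC h *t TY i *t TY i)
| rel_xjyi i j : (i < j)%O ->
    hrel (TX j *t TY i) (TY i *t TX j +t TC h *t TY i *t TY j)
| rel_yjxi i j : (i < j)%O ->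
    hrel (TY j *t TX i) (TX i *t TY j +t TC (- h) *t TY i *t TY j)
| rel_yjyi i j : (i < j)%O -> hrel (TY j *t TY i) (TY i *t TY j)
| rel_xjxi i j : (i < j)%O ->
    hrel (TX j *t TX i)
        (TX i *t TX j +t TC (- h) *t TX i *t TY j +t TC h *t TY i *t TX j
         +t TC (h ^+ 2) *t TY i *t TY j).

(* The least congruence whose quotient is a unital K-algebra satisfying the
   relations; TC c is the scalar c times the unit. *)
Inductive tcong : hterm -> hterm -> Prop :=
| tc_rel a b : hrel a b -> tcong a b
| tc_refl a : tcong a a
| tc_sym a b : tcong a b -> tcong b a
| tc_trans a b c : tcong a b -> tcong b c -> tcong a c
| tc_add a a' b b' : tcong a a' -> tcong b b' -> tcong (a +t b) (a' +t b')
| tc_mul a a' b b' : tcong a a' -> tcong b b' -> tcong (a *t b) (a' *t b')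
| tc_addA a b c : tcong (a +t (b +t c)) (a +t b +t c)
| tc_addC a b : tcong (a +t b) (b +t a)
| tc_add0 a : tcong (TC 0 +t a) a
| tc_mulA a b c : tcong (a *t (b *t c)) (a *t b *t c)
| tc_mul1l a : tcong (TC 1 *t a) a
| tc_mul1r a : tcong (a *t TC 1) a
| tc_mulDl a b c : tcong ((a +t b) *t c) (a *t c +t b *t c)
| tc_mulDr a b c : tcong (a *t (b +t c)) (a *t b +t a *t c)
| tc_mul0l a : tcong (TC 0 *t a) (TC 0)
| tc_constD c d : tcong (TC (c + d)) (TC c +t TC d)
| tc_constM c d : tcong (TC (c * d)) (TC c *t TC d)
| tc_constC c a : tcong (a *t TC c) (TC c *t a).

HB.instance Definition _ := gen_eqMixin hterm.
HB.instance Definition _ := gen_choiceMixin hterm.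

Definition tcongb (a b : hterm) : bool := `[< tcong a b >].

Lemma tcongb_equiv : equiv_class_of tcongb.
Proof.
split=> [a|a b|b a c]; rewrite /tcongb.
- by apply/asboolP; exact: tc_refl.
- by apply/asboolP/asboolP; exact: tc_sym.
- by move=> /asboolP ab /asboolP bc; apply/asboolP; exact: tc_trans bc.
Qed.
Canonical tcongb_rel := EquivRelPack tcongb_equiv.

(* The algebra H_I, presented by the generators x_i = hx i, y_i = hy i and the
   relations hrel. *)
Definition hAlg : Type := {eq_quot tcongb}.
HB.instance Definition _ := Choice.on hAlg.

Definition cls (a : hterm) : hAlg := \pi_{eq_quot tcongb} a.
Definition rep (v : hAlg) : hterm := repr (v : {eq_quot tcongb}).

Lemma repK : cancel rep cls. Proof. exact: reprK. Qed.

Lemma clsP a b : cls a = cls b <-> tcong a b.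
Proof.
rewrite /cls; split=> [/eqmodP/asboolP //|ab].
by apply/eqmodP/asboolP.
Qed.

Lemma rep_cls a : tcong (rep (cls a)) a. Proof. by apply/clsP; rewrite repK. Qed.

Definition addH (u v : hAlg) : hAlg := cls (rep u +t rep v).
Definition mulH (u v : hAlg) : hAlg := cls (rep u *t rep v).
Definition scaleH (c : K) (v : hAlg) : hAlg := cls (TC c *t rep v).
Definition oppH (v : hAlg) : hAlg := scaleH (- 1) v.

Lemma clsD a b : cls (a +t b) = addH (cls a) (cls b).
Proof. by apply/clsP/tc_add; apply/tc_sym/rep_cls. Qed.
Lemma clsM a b : cls (a *t b) = mulH (cls a) (cls b).
Proof. by apply/clsP/tc_mul; apply/tc_sym/rep_cls. Qed.
Lemma clsZ c a : cls (TC c *t a) = scaleH c (cls a).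
Proof. by apply/clsP/tc_mul; [exact: tc_refl | apply/tc_sym/rep_cls]. Qed.

Lemma hAlgW (P : hAlg -> Prop) : (forall a, P (cls a)) -> forall v, P v.
Proof. by move=> Pc v; rewrite -[v]repK. Qed.

Lemma addHA : associative addH.
Proof.
elim/hAlgW => a; elim/hAlgW => b; elim/hAlgW => c.
by rewrite -!clsD; apply/clsP/tc_addA.
Qed.
Lemma addHC : commutative addH.
Proof.
by elim/hAlgW => a; elim/hAlgW => b; rewrite -!clsD; apply/clsP/tc_addC.
Qed.
Lemma add0H : left_id (cls (TC 0)) addH.
Proof. by elim/hAlgW => a; rewrite -clsD; apply/clsP/tc_add0. Qed.
Lemma scale1H : left_id 1 scaleH.
Proof. by elim/hAlgW => a; rewrite -clsZ; apply/clsP/tc_mul1l. Qed.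
Lemma scaleHDl v c d : scaleH (c + d) v = addH (scaleH c v) (scaleH d v).
Proof.
elim/hAlgW: v => a; rewrite -!clsZ -clsD; apply/clsP.
by apply: tc_trans (tc_mulDl _ _ _); apply: tc_mul (tc_refl _); apply: tc_constD.
Qed.
Lemma scale0H v : scaleH 0 v = cls (TC 0).
Proof. by elim/hAlgW: v => a; rewrite -clsZ; apply/clsP/tc_mul0l. Qed.
Lemma addNH : left_inverse (cls (TC 0)) oppH addH.
Proof. by move=> v; rewrite -{2}[v]scale1H -scaleHDl addNr scale0H. Qed.
HB.instance Definition _ := GRing.isZmodule.Build hAlg addHA addHC add0H addNH.

Lemma mulHA : associative mulH.
Proof.
elim/hAlgW => a; elim/hAlgW => b; elim/hAlgW => c.
by rewrite -!clsM; apply/clsP/tc_mulA.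
Qed.
Lemma mul1H : left_id (cls (TC 1)) mulH.
Proof. by elim/hAlgW => a; rewrite -clsM; apply/clsP/tc_mul1l. Qed.
Lemma mulH1 : right_id (cls (TC 1)) mulH.
Proof. by elim/hAlgW => a; rewrite -clsM; apply/clsP/tc_mul1r. Qed.
Lemma mulHDl : left_distributive mulH addH.
Proof.
elim/hAlgW => a; elim/hAlgW => b; elim/hAlgW => c.
by rewrite -clsD -!clsM -clsD; apply/clsP/tc_mulDl.
Qed.
Lemma mulHDr : right_distributive mulH addH.
Proof.
elim/hAlgW => a; elim/hAlgW => b; elim/hAlgW => c.
by rewrite -clsD -!clsM -clsD; apply/clsP/tc_mulDr.
Qed.

Fixpoint constant_term (a : hterm) : K :=
  match a with
  | TX _ | TY _ => 0
  | TC c => c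
  | TA a b => constant_term a + constant_term b
  | TM a b => constant_term a * constant_term b
  end.

Lemma oneH_neq0 : cls (TC 1) != 0.
Proof.
suff ct a b : tcong a b -> constant_term a = constant_term b.
  by apply/eqP => /clsP /ct /= /eqP; rewrite oner_eq0.
elim=> {a b} /=; try by [].
- by move=> a b []; move=> *; rewrite /= ?(mulr0, mul0r, addr0).
- by move=> a b c _ -> _ ->.
- by move=> a a' b b' _ -> _ ->.
- by move=> a a' b b' _ -> _ ->.
all: move=> *; ring.
Qed.
HB.instance Definition _ := GRing.Zmodule_isNzRing.Build hAlg
  mulHA mul1H mulH1 mulHDl mulHDr oneH_neq0.

Lemma scaleHA c d v : scaleH c (scaleH d v) = scaleH (c * d) v.
Proof.
elim/hAlgW: v => a; rewrite -!clsZ; apply/clsP.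
apply: tc_trans (tc_mulA _ _ _) _; apply: tc_mul (tc_refl _).
exact/tc_sym/tc_constM.
Qed.
Lemma scaleHDr : right_distributive scaleH addH.
Proof.
move=> c; elim/hAlgW => a; elim/hAlgW => b.
by rewrite -clsD -!clsZ -clsD; apply/clsP/tc_mulDr.
Qed.
HB.instance Definition _ := GRing.Zmodule_isLmodule.Build K hAlg
  scaleHA scale1H scaleHDr (fun v c d => scaleHDl v c d).

Lemma scaleHAl (c : K) (u v : hAlg) : c *: (u * v) = (c *: u) * v.
Proof.
elim/hAlgW: u => a; elim/hAlgW: v => b.
by apply/clsP; do ![apply: tc_trans (tc_mul (tc_refl _) (rep_cls _)) _];
  apply: tc_trans (tc_mulA _ _ _) _; apply: tc_mul (tc_refl _);
  apply/tc_sym/rep_cls.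
Qed.
HB.instance Definition _ := GRing.Lmodule_isLalgebra.Build K hAlg scaleHAl.

Lemma scaleHAr (c : K) (u v : hAlg) : c *: (u * v) = u * (c *: v).
Proof.
have cA w : c *: w = cls (TC c) * w.
  by elim/hAlgW: w => b; rewrite -[RHS]clsM -[LHS]clsZ.
rewrite !cA !mulrA; congr (_ * v).
elim/hAlgW: u => a; rewrite -[LHS]clsM -[RHS]clsM.
exact/clsP/tc_sym/tc_constC.
Qed.
HB.instance Definition _ := GRing.Lalgebra_isAlgebra.Build K hAlg scaleHAr.

Definition hx (i : I) : hAlg := cls (TX i).
Definition hy (i : I) : hAlg := cls (TY i).

Lemma cls_const c : cls (TC c) = c%:A.
Proof. by rewrite -[RHS]clsZ; apply/clsP/tc_sym/tc_mul1r. Qed.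
Lemma cls_add a b : cls (a +t b) = cls a + cls b. Proof. exact: clsD. Qed.
Lemma cls_mul a b : cls (a *t b) = cls a * cls b. Proof. exact: clsM. Qed.

Lemma hAlg_ind (P : hAlg -> Prop) :
  (forall i, P (hx i)) -> (forall i, P (hy i)) -> P 1 ->
  (forall c u, P u -> P (c *: u)) -> (forall u v, P u -> P v -> P (u + v)) ->
  (forall u v, P u -> P v -> P (u * v)) -> forall v, P v.
Proof.
move=> Px Py P1 PZ PD PM; elim/hAlgW; elim=> [i|i|c|a Pa b Pb|a Pa b Pb].
- exact: Px.
- exact: Py.
- by rewrite cls_const; apply: PZ.
- by rewrite cls_add; apply: PD.
- by rewrite cls_mul; apply: PM.
Qed.

Lemma hxy i : hx i * hy i = hy i * hx i + h *: hy i ^+ 2.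
Proof.
have /clsP := tc_rel (rel_xy i).
by rewrite !(cls_add, cls_mul, cls_const) mulr_algl -scalerAl.
Qed.
Lemma hxjyi i j : (i < j)%O -> hx j * hy i = hy i * hx j + h *: (hy i * hy j).
Proof.
move=> /rel_xjyi/tc_rel/clsP.
by rewrite !(cls_add, cls_mul, cls_const) mulr_algl -scalerAl.
Qed.
Lemma hyjxi i j : (i < j)%O -> hy j * hx i = hx i * hy j - h *: (hy i * hy j).
Proof.
move=> /rel_yjxi/tc_rel/clsP.
by rewrite !(cls_add, cls_mul, cls_const) mulr_algl -scalerAl scaleNr.
Qed.
Lemma hyjyi i j : (i < j)%O -> hy j * hy i = hy i * hy j.
Proof. by move=> /rel_yjyi/tc_rel/clsP; rewrite !cls_mul. Qed.
Lemma hxjxi i j : (i < j)%O ->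
  hx j * hx i = hx i * hx j - h *: (hx i * hy j) + h *: (hy i * hx j)
                + h ^+ 2 *: (hy i * hy j).
Proof.
move=> /rel_xjxi/tc_rel/clsP.
by rewrite !(cls_add, cls_mul, cls_const) !mulr_algl -!scalerAl scaleNr.
Qed.

(* Linear identities between at most four elements of H_I are decided by ring
   after encoding these elements as 1, 'X, 'X^2 and 'X^3. *)
Lemma lin4 (a b c d : hAlg) : exists phi : {poly K} -> hAlg,
  [/\ phi 1 = a, phi 'X = b, phi 'X^2 = c & phi 'X^3 = d] /\
  [/\ phi 0 = 0, forall p q, phi p + phi q = phi (p + q),
      forall p, - phi p = phi (- p) & forall t p, t *: phi p = phi (t%:P * p)].
Proof.
pose s := [:: a; b; c; d].
exists (fun p => \sum_(k < 4) p`_k *: s`_k); split.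
  rewrite !big_ord_recl !big_ord0 /=.
  by rewrite !coef1 !coefX !coefXn /= !scale1r !scale0r !(addr0, add0r).
split=> [|p q|p|t p].
- by rewrite big1 // => k _; rewrite coef0 scale0r.
- by rewrite -big_split; apply: eq_bigr => k _; rewrite coefD scalerDl.
- by rewrite -sumrN; apply: eq_bigr => k _; rewrite coefN scaleNr.
- by rewrite scaler_sumr; apply: eq_bigr => k _; rewrite coefCM scalerA.
Qed.

Fixpoint F_term (a : hterm) : hAlg :=
  match a with
  | TX i => hy i
  | TY _ | TC _ => 0
  | TA a b => F_term a + F_term b
  | TM a b => F_term a * cls b + cls a * F_term b
  end.
(* Well defined on classes by F_cong. *)
Definition opF (v : hAlg) : hAlg := F_term (rep v).

Ltac decide4 a b c d :=
  let phi := fresh "phi" in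
  let E1 := fresh in let E2 := fresh in let E3 := fresh in let E4 := fresh in
  let E0 := fresh in let ED := fresh in let EN := fresh in let EZ := fresh in
  have [phi [[E1 E2 E3 E4] [E0 ED EN EZ]]] := lin4 a b c d;
  rewrite -?E1 -?E2 -?E3 -?E4; rewrite ?EZ ?EN ?ED ?EZ ?EN ?ED ?EZ ?EN ?ED -?E0;
  congr (phi _); rewrite ?rmorphM ?rmorphN ?rmorphXn /=; ring.

Ltac expand := rewrite ?(mul0r, mulr0, add0r, addr0, mulrDl, mulrDr, mulrN,
  mulNr, mulr_algl, expr2, scaler0) -?(scalerAl, scalerAr) ?(scalerDr, scalerN) ?scalerA.

Lemma F_cong a b : tcong a b -> F_term a = F_term b.
Proof.
elim=> {a b} /=; try by [].
- move=> a b [i|i j ij|i j ij|i j ij|i j ij] /=;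
    rewrite ?(cls_mul, cls_const) -?/(hx _) -?/(hy _).

  + by expand.
  + by expand; rewrite (hyjyi ij).
  + by expand; rewrite (hyjyi ij).
  + by expand.
  + expand; rewrite (hxjyi ij) (hyjxi ij).
    decide4 (hy i * hy j) (hy i * hx j) (hx i * hx j) (hx i * hy j).
- by move=> a b c _ -> _ ->.
- by move=> a a' b b' _ -> _ ->.
- by move=> a a' b b' /clsP-> -> /clsP-> ->.
- by move=> a b c; rewrite addrA.
- by move=> a b; rewrite addrC.
- by move=> a; rewrite add0r.
- by move=> a b c; rewrite !cls_mul mulrDl mulrDr !mulrA addrA.
- by move=> a; rewrite cls_const scale1r mul0r mul1r add0r.
- by move=> a; rewrite cls_const scale1r mulr0 mulr1 addr0.
- by move=> a b c; rewrite cls_add !mulrDl addrACA.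
- by move=> a b c; rewrite cls_add !mulrDr addrACA.
- by move=> a; rewrite cls_const scale0r !mul0r addr0.
- by move=> *; rewrite addr0.
- by move=> *; rewrite mulr0 mul0r addr0.
- by move=> c a; rewrite cls_const mulr0 mul0r addr0 add0r mulr_algl mulr_algr.
Qed.

Lemma opF_cls a : opF (cls a) = F_term a. Proof. exact/F_cong/rep_cls. Qed.

Lemma opF_x i : opF (hx i) = hy i. Proof. exact: opF_cls. Qed.
Lemma opF_y i : opF (hy i) = 0. Proof. exact: opF_cls. Qed.
Lemma opF_1 : opF 1 = 0. Proof. exact: opF_cls. Qed.
Lemma opFM u v : opF (u * v) = opF u * v + u * opF v.
Proof.
by elim/hAlgW: u => a; elim/hAlgW: v => b; rewrite -cls_mul !opF_cls.
Qed.
Lemma opF_linear : linear opF.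
Proof.
move=> c; elim/hAlgW => a; elim/hAlgW => b.
rewrite -[c *: _]mulr_algl -cls_const -cls_mul -cls_add !opF_cls /=.
by rewrite mul0r add0r cls_const mulr_algl.
Qed.
HB.instance Definition _ := GRing.isLinear.Build K hAlg hAlg _ opF opF_linear.

Lemma iter_opFD m u v : iter m opF (u + v) = iter m opF u + iter m opF v.
Proof. by elim: m => //= m ->; rewrite linearD. Qed.
Lemma iter_opFZ m c u : iter m opF (c *: u) = c *: iter m opF u.
Proof. by elim: m => //= m ->; rewrite linearZ. Qed.
Lemma iter_opF0 m : iter m opF 0 = 0.
Proof. by elim: m => //= m ->; rewrite linear0. Qed.
Lemma iter_opF_ge N m v : (N <= m)%N -> iter N opF v = 0 -> iter m opF v = 0.
Proof. by move=> Nm v0; rewrite -(subnK Nm) iterD v0 iter_opF0. Qed.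

Lemma iter_opFM N1 N2 u v : iter N1 opF u = 0 -> iter N2 opF v = 0 ->
  iter (N1 + N2) opF (u * v) = 0.
Proof.
elim: N1 N2 u v => [|N1 IH1] N2 u v; first by move=> /= ->; rewrite mul0r iter_opF0.
elim: N2 v => [|N2 IH2] v u0; first by move=> /= ->; rewrite mulr0 -iterS iter_opF0.
move=> v0; rewrite addSn addnS iterSr opFM iter_opFD -addSn IH2 //; last first.
  by rewrite -iterSr.
by rewrite addSnnS IH1 ?addr0 // -iterSr.
Qed.

Lemma opF_nilp v : exists N, iter N opF v == 0.
Proof.
elim/hAlg_ind: v => [i|i||c u [N /eqP u0]|u v [N /eqP u0] [M /eqP v0]|
  u v [N /eqP u0] [M /eqP v0]].
- by exists 2%N; rewrite /= opF_x opF_y.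
- by exists 1%N; rewrite /= opF_y.
- by exists 1%N; rewrite /= opF_1.
- by exists N; rewrite iter_opFZ u0 scaler0.
- exists (N + M)%N; rewrite iter_opFD (iter_opF_ge (leq_addr _ _) u0).
  by rewrite (iter_opF_ge (leq_addl _ _) v0) addr0.
- by exists (N + M)%N; rewrite iter_opFM.
Qed.

(* e^{tF}: F is locally nilpotent, so the exponential series evaluated at v is
   a finite sum (expF_sum: any longer partial sum gives the same value). *)
Definition expF (t : K) (v : hAlg) : hAlg :=
  \sum_(m < ex_minn (opF_nilp v)) (t ^+ m / m`!%:R) *: iter m opF v.

Lemma expF_sum t v N : iter N opF v = 0 ->
  expF t v = \sum_(m < N) (t ^+ m / m`!%:R) *: iter m opF v.
Proof.
move=> v0; rewrite /expF; case: ex_minnP => M /eqP vM /(_ N).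
rewrite v0 eqxx => /(_ isT) MN.
pose g m := (t ^+ m / m`!%:R) *: iter m opF v.
rewrite -(big_mkord xpredT g) -[RHS](big_mkord xpredT g).
rewrite [RHS](big_cat_nat (n := M)) //= [X in _ + X]big_nat_cond.
rewrite [X in _ + X]big1 ?addr0 // => m; rewrite andbT => /andP[Mm _].
by rewrite /g (iter_opF_ge Mm vM) scaler0.
Qed.

Lemma expF_linear t : linear (expF t).
Proof.
move=> c u v; have [N /eqP u0] := opF_nilp u; have [M /eqP v0] := opF_nilp v.
have u0' := iter_opF_ge (leq_addr M N) u0.
have v0' := iter_opF_ge (leq_addl N M) v0.
rewrite (expF_sum t u0') (expF_sum t v0') (@expF_sum t _ (N + M)); last first.
  by rewrite iter_opFD iter_opFZ u0' v0' scaler0 addr0.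
rewrite scaler_sumr -big_split; apply: eq_bigr => m _.
by rewrite iter_opFD iter_opFZ scalerDr !scalerA mulrC.
Qed.
HB.instance Definition _ t :=
  GRing.isLinear.Build K hAlg hAlg _ (expF t) (expF_linear t).

Lemma expF1 t : expF t 1 = 1.
Proof.
by rewrite (@expF_sum t 1 1) /= ?opF_1 // big_ord1 /= expr0 divr1 scale1r.
Qed.

Lemma iter_opF_gen g v m : opF (opF g) = 0 ->
  iter m opF (g * v) = g * iter m opF v + m%:R *: (opF g * iter m.-1 opF v).
Proof.
move=> g0; elim: m => [|m IH]; first by rewrite scale0r addr0.
rewrite iterS IH linearD linearZ /= !opFM g0 mul0r add0r.
rewrite [opF g * _ + _]addrC -addrA; congr (_ + _).
case: m {IH} => [|m]; first by rewrite scale0r addr0 scale1r.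
by rewrite -[m.+2]addn1 natrD scalerDl scale1r addrC.
Qed.

Lemma expF_gen t g v : opF (opF g) = 0 ->
  expF t (g * v) = (g + t *: opF g) * expF t v.
Proof.
move=> g0; have [N /eqP v0] := opF_nilp v.
have v0' : iter N.+1 opF v = 0 by rewrite iterS v0 linear0.
rewrite (@expF_sum t (g * v) N.+1); last first.
  by rewrite iter_opF_gen // v0' v0 !mulr0 scaler0 addr0.
under eq_bigr do rewrite iter_opF_gen // scalerDr scalerAr.
rewrite big_split /= -mulr_sumr -(expF_sum t v0') mulrDl.
congr (_ + _); rewrite big_ord_recl /= scale0r scaler0 add0r.
rewrite (expF_sum t v0) mulr_sumr; apply: eq_bigr => m _.
rewrite /bump /= add1n -scalerAl -scalerAr !scalerA; congr (_ *: _).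
have m0 : m.+1%:R != 0 :> K by rewrite pnatr_eq0.
have f0 : m`!%:R != 0 :> K by rewrite pnatr_eq0 -lt0n fact_gt0.
rewrite factS natrM exprS; move: (m.+1%:R) m0 (m`!%:R) f0 => a a0 b b0.
by field; rewrite a0 b0.
Qed.

Lemma expF_x t i : expF t (hx i) = hx i + t *: hy i.
Proof.
by have := @expF_gen t (hx i) 1; rewrite opF_x opF_y expF1 !mulr1 => ->.
Qed.
Lemma expF_y t i : expF t (hy i) = hy i.
Proof.
have := @expF_gen t (hy i) 1.
by rewrite opF_y linear0 expF1 !mulr1 scaler0 addr0 => ->.
Qed.

Lemma expFM t u v : expF t (u * v) = expF t u * expF t v.
Proof.
elim/hAlg_ind: u v => [i|i||c u IH|u1 u2 IH1 IH2|u1 u2 IH1 IH2] v.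
- by rewrite expF_gen ?opF_x ?opF_y // expF_x.
- have := @expF_gen t (hy i) v.
  by rewrite opF_y linear0 scaler0 addr0 expF_y => ->.
- by rewrite expF1 !mul1r.
- by rewrite -scalerAl linearZ /= IH linearZ /= scalerAl.
- by rewrite mulrDl linearD /= IH1 IH2 linearD /= mulrDl.
- by rewrite -mulrA !IH1 IH2 mulrA.
Qed.

(* The operator D with values gx, gy on the generators and
   D (ab) = D a * e^{-hF} b + e^{hF} a * D b. *)
Fixpoint skew_term (gx gy : I -> hAlg) (a : hterm) : hAlg :=
  match a with
  | TX i => gx i
  | TY i => gy i
  | TC _ => 0
  | TA a b => skew_term gx gy a + skew_term gx gy b
  | TM a b => skew_term gx gy a * expF (- h) (cls b)
              + expF h (cls a) * skew_term gx gy b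
  end.

Definition E_term := skew_term (fun=> 0) hx.
Definition H_term := skew_term hx (fun i => - hy i).

(* Well defined on classes by E_cong and H_cong. *)
Definition opE (v : hAlg) : hAlg := E_term (rep v).
Definition opH (v : hAlg) : hAlg := H_term (rep v).

Lemma expF_const t c : expF t (cls (TC c)) = c%:A.
Proof. by rewrite cls_const linearZ /= expF1. Qed.

Lemma skew_cong gx gy :
  (forall a b, hrel a b -> skew_term gx gy a = skew_term gx gy b) ->
  forall a b, tcong a b -> skew_term gx gy a = skew_term gx gy b.
Proof.
move=> rel_ok a b; elim=> {a b} /=; try by [].
- by move=> a b c _ -> _ ->.
- by move=> a a' b b' _ -> _ ->.
- by move=> a a' b b' /clsP-> -> /clsP-> ->.
- by move=> a b c; rewrite addrA.
- by move=> a b; rewrite addrC.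
- by move=> a; rewrite add0r.
- by move=> a b c; rewrite !cls_mul !expFM mulrDl mulrDr !mulrA addrA.
- by move=> a; rewrite expF_const scale1r mul0r mul1r add0r.
- by move=> a; rewrite expF_const scale1r mulr0 mulr1 addr0.
- by move=> a b c; rewrite cls_add linearD /= !mulrDl addrACA.
- by move=> a b c; rewrite cls_add linearD /= !mulrDr addrACA.
- by move=> a; rewrite expF_const scale0r !mul0r addr0.
- by move=> *; rewrite addr0.
- by move=> *; rewrite mulr0 mul0r addr0.
- by move=> c a; rewrite !expF_const mulr0 mul0r addr0 add0r mulr_algl mulr_algr.
Qed.

Lemma E_cong a b : tcong a b -> E_term a = E_term b.
Proof.
apply: skew_cong => {a b} a b [i|i j ij|i j ij|i j ij|i j ij] /=;
  rewrite ?(cls_mul, expFM, expF_const) -?/(hx _) -?/(hy _) ?expF_x ?expF_y.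
- expand; rewrite ?hxy; expand.
  decide4 (hy i * hy i) (hy i * hx i) (hx i * hx i) (1 : hAlg).
- expand; rewrite ?(hxjxi ij, hxjyi ij, hyjyi ij, hyjxi ij); expand.
  decide4 (hy i * hy j) (hy i * hx j) (hx i * hx j) (hx i * hy j).
- expand; rewrite ?(hxjxi ij, hxjyi ij, hyjyi ij, hyjxi ij); expand.
  decide4 (hy i * hy j) (hy i * hx j) (hx i * hx j) (hx i * hy j).
- expand; rewrite ?(hxjxi ij, hxjyi ij, hyjyi ij, hyjxi ij); expand.
  decide4 (hy i * hy j) (hy i * hx j) (hx i * hx j) (hx i * hy j).
- expand; rewrite ?(hxjxi ij, hxjyi ij, hyjyi ij, hyjxi ij); expand.
  decide4 (hy i * hy j) (hy i * hx j) (hx i * hx j) (hx i * hy j).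
Qed.

Lemma H_cong a b : tcong a b -> H_term a = H_term b.
Proof.
apply: skew_cong => {a b} a b [i|i j ij|i j ij|i j ij|i j ij] /=;
  rewrite ?(cls_mul, expFM, expF_const) -?/(hx _) -?/(hy _) ?expF_x ?expF_y.
- expand; rewrite ?hxy; expand.
  decide4 (hy i * hy i) (hy i * hx i) (hx i * hx i) (1 : hAlg).
- expand; rewrite ?(hxjxi ij, hxjyi ij, hyjyi ij, hyjxi ij); expand.
  decide4 (hy i * hy j) (hy i * hx j) (hx i * hx j) (hx i * hy j).
- expand; rewrite ?(hxjxi ij, hxjyi ij, hyjyi ij, hyjxi ij); expand.
  decide4 (hy i * hy j) (hy i * hx j) (hx i * hx j) (hx i * hy j).
- expand; rewrite ?(hxjxi ij, hxjyi ij, hyjyi ij, hyjxi ij); expand.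
  decide4 (hy i * hy j) (hy i * hx j) (hx i * hx j) (hx i * hy j).
- expand; rewrite ?(hxjxi ij, hxjyi ij, hyjyi ij, hyjxi ij); expand.
  decide4 (hy i * hy j) (hy i * hx j) (hx i * hx j) (hx i * hy j).
Qed.

Lemma opE_cls a : opE (cls a) = E_term a. Proof. exact/E_cong/rep_cls. Qed.
Lemma opE_x i : opE (hx i) = 0. Proof. exact: opE_cls. Qed.
Lemma opE_y i : opE (hy i) = hx i. Proof. exact: opE_cls. Qed.
Lemma opE_1 : opE 1 = 0. Proof. exact: opE_cls. Qed.
Lemma opEM u v : opE (u * v) = opE u * expF (- h) v + expF h u * opE v.
Proof.
by elim/hAlgW: u => a; elim/hAlgW: v => b; rewrite -cls_mul !opE_cls.
Qed.
Lemma opE_linear : linear opE.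
Proof.
move=> c; elim/hAlgW => a; elim/hAlgW => b.
rewrite -[c *: _]mulr_algl -cls_const -cls_mul -cls_add !opE_cls.
rewrite {1}/E_term /= -/E_term mul0r add0r.
by rewrite expF_const mulr_algl.
Qed.
HB.instance Definition _ := GRing.isLinear.Build K hAlg hAlg _ opE opE_linear.

Lemma opH_cls a : opH (cls a) = H_term a. Proof. exact/H_cong/rep_cls. Qed.
Lemma opH_x i : opH (hx i) = hx i. Proof. exact: opH_cls. Qed.
Lemma opH_y i : opH (hy i) = - hy i. Proof. exact: opH_cls. Qed.
Lemma opH_1 : opH 1 = 0. Proof. exact: opH_cls. Qed.
Lemma opHM u v : opH (u * v) = opH u * expF (- h) v + expF h u * opH v.
Proof.
by elim/hAlgW: u => a; elim/hAlgW: v => b; rewrite -cls_mul !opH_cls.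
Qed.
Lemma opH_linear : linear opH.
Proof.
move=> c; elim/hAlgW => a; elim/hAlgW => b.
rewrite -[c *: _]mulr_algl -cls_const -cls_mul -cls_add !opH_cls.
rewrite {1}/H_term /= -/H_term mul0r add0r.
by rewrite expF_const mulr_algl.
Qed.
HB.instance Definition _ := GRing.isLinear.Build K hAlg hAlg _ opH opH_linear.

Definition is_invariant (v : hAlg) : Prop :=
  [/\ opE v = 0, opF v = 0 & opH v = 0].

(* The unital subalgebra H_J generated by the x_i, y_i with i in J *)
Inductive in_subalg (J : I -> Prop) : hAlg -> Prop :=
| sub_x i : J i -> in_subalg J (hx i)
| sub_y i : J i -> in_subalg J (hy i)
| sub_1 : in_subalg J 1
| sub_scale c u : in_subalg J u -> in_subalg J (c *: u)
| sub_add u v : in_subalg J u -> in_subalg J v -> in_subalg J (u + v)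
| sub_mul u v : in_subalg J u -> in_subalg J v -> in_subalg J (u * v).

(* v is a linear combination of monomials having exactly n factors among
   x_j, y_j; in a monomial, (i, false) stands for x_i and (i, true) for y_i. *)
Definition homogeneous (j : I) (n : nat) (v : hAlg) : Prop :=
  exists s : seq (K * seq (I * bool)),
    (forall p, p \in s -> count (fun g => g.1 == j) p.2 = n) /\
    v = \sum_(p <- s) p.1 *: \prod_(g <- p.2) (if g.2 then hy g.1 else hx g.1).

Definition bracket (i j : I) : hAlg :=
  hx i * hy j - hy i * hx j - h *: (hy i * hy j).

Definition form_expansion (o : I) (n : nat) (A : 'I_n.+1 -> hAlg) (f : hAlg) : Prop :=
  (forall i, in_subalg (fun j => j != o) (A i)) /\
  f = \sum_(i < n.+1) 'C(n, i)%:R *: (hx o ^+ (n - i) * hy o ^+ i * A i).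

Definition is_form (o : I) (n : nat) (A : 'I_n.+1 -> hAlg) (f : hAlg) : Prop :=
  [/\ f != 0, is_invariant f & form_expansion o A f].

Definition multilinear_expr (k n : nat) (c : {ffun {ffun 'I_k -> 'I_n.+1} -> K})
    (A : 'I_k -> 'I_n.+1 -> hAlg) : hAlg :=
  \sum_(m : {ffun 'I_k -> 'I_n.+1}) c m *: \prod_(j < k) A j (m j).

(* Invariants of degree k of the form with coefficients A: the coefficients do
   not commute, so a homogeneous polynomial expression of degree k in them is a
   linear combination of the ordered words of length k. *)
Definition invariant_of_degree (o : I) (k n : nat) (A : 'I_n.+1 -> hAlg)
    (v : hAlg) : Prop :=
  [/\ exists c : {ffun {ffun 'I_k -> 'I_n.+1} -> K},
        v = multilinear_expr c (fun=> A),
      in_subalg (fun j => j != o) v & is_invariant v].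

End ModuleAlgebra.

(* Main.v *)
(* The relations of [H_I] do not depend on the order of [I]:
   [x_i, y_j] = h y_i y_j, [x_j, x_i] = h (y_i x_j - y_j x_i), [y_i, y_j] = 0.
   The twisted derivation [pderx o], dual to [x_o], kills the subalgebra without
   the index [o], and [pderx o \o opE] lowers powers of [y_o]; hence the
   [x_o^(n-i) y_o^i] are free over that subalgebra. Comparing coefficients in
   [E f = F f = H f = 0], the generators and [e^(tF)] act on the coefficients
   [A_i] of any invariant [n]-form by matrices that depend on [n] only.
   Replacing every [A^(j)_i] by [A_i] in a linear combination of the products
   [A^(1)_{i_1} ... A^(k)_{i_k}], which are linearly independent, therefore
   commutes with [E], [F] and [H]. The bracket [(0j)] commutes with [x_j] and
   [y_j], so its powers can be expanded recursively, and the coefficients of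
   [(0j)^n] are obtained from the [y_j^(n-p) x_j^p] by an invertible triangular
   matrix. *)

Require Import Defs.
From HB Require Import structures.
From mathcomp Require Import all_boot all_order all_algebra.
From mathcomp Require Import ring.
From mathcomp Require Import boolp reals complex.

Set Implicit Arguments.
Unset Strict Implicit.
Unset Printing Implicit Defensive.

Import Order.TTheory GRing.Theory Num.Theory.
Local Open Scope ring_scope.

(** The four elements are encoded by powers of an indeterminate and all linear operations are pushed
    into [phi] until none is left outside, so that [ring] sees a polynomial identity. *)
Ltac linear4 a b c d :=
  let phi := fresh "phi" in
  let Ea := fresh in let Eb := fresh in let Ec := fresh in let Ed := fresh in
  let E0 := fresh in let ED := fresh in let EN := fresh in let EZ := fresh in
  have [phi [[Ea Eb Ec Ed] [E0 ED EN EZ]]] := lin4 a b c d;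
  rewrite -?Ea -?Eb -?Ec -?Ed;
  repeat (progress rewrite ?EZ ?EN ?ED); rewrite -?E0;
  congr (phi _); rewrite ?rmorphD ?rmorphM ?rmorphN ?rmorphXn ?rmorph1 /=; ring.

(** * Relations and twisted derivations *)

Section Relations.
Context (K : numFieldType) (disp : Order.disp_t) (I : orderType disp) (h : K).
Local Notation H := (hAlg I h).
Local Notation x := (hx h).
Local Notation y := (hy h).
Implicit Types (u v w : H) (i j o : I).

Lemma yyC i j : y i * y j = y j * y i.
Proof.
by case: (ltgtP i j) => [ij|ij|->//]; [rewrite (hyjyi _ ij) | rewrite (hyjyi _ ij)].
Qed.

(** The relations for both orders of the indices and for equal indices give one and the same
    commutator, so later computations need not compare indices. *)
Lemma xyE i j : x i * y j = y j * x i + h *: (y i * y j).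
Proof.
case: (ltgtP i j) => [ij|ij|->]; last by rewrite hxy expr2.
- by rewrite (hyjxi _ ij) subrK.
- by rewrite (hxjyi _ ij) [y j * y i]yyC.
Qed.

Lemma yxE i j : y j * x i = (x i - h *: y i) * y j.
Proof. by rewrite mulrBl xyE -scalerAl addrK. Qed.

Lemma xxE i j : x j * x i = x i * x j + h *: (y i * x j) - h *: (y j * x i).
Proof.
have main (a b : I) : (a < b)%O ->
    x b * x a = x a * x b + h *: (y a * x b) - h *: (y b * x a).
  (* Reordering [x a * y b] absorbs the term in [h ^+ 2]; the remaining commutator is antisymmetric
     in the two indices, which settles the opposite order. *)
  move=> ab; rewrite (hxjxi _ ab) [x a * y b]xyE expr2 -scalerA [y a * y b]yyC.
  by linear4 (x a * x b) (y b * x a) (y b * y a) (y a * x b).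
case: (ltgtP i j) => [ij|ij|->]; [exact: main| |by rewrite addrK].
rewrite (main _ _ ij) addrAC. by linear4 (x j * x i) (y i * x j) (y j * x i) (1:H).
Qed.

Lemma expF0 v : expF 0 v = v.
Proof.
elim/hAlg_ind: v => [i|i||c u E|u v Eu Ev|u v Eu Ev].
- by rewrite expF_x scale0r addr0.
- by rewrite expF_y.
- by rewrite expF1.
- by rewrite linearZ /= E.
- by rewrite linearD /= Eu Ev.
- by rewrite expFM Eu Ev.
Qed.

(** Both sides are multiplicative in [v], so generators suffice. This group law makes every [expF t]
    invertible, which is how twists are removed below. *)
Lemma expFD s t v : expF s (expF t v) = expF (s + t) v.
Proof.
elim/hAlg_ind: v => [i|i||c u E|u v Eu Ev|u v Eu Ev].
- by rewrite !expF_x linearD linearZ /= expF_x expF_y scalerDl addrA.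
- by rewrite !expF_y.
- by rewrite !expF1.
- by rewrite !linearZ /= E.
- by rewrite !linearD /= Eu Ev.
- by rewrite !expFM Eu Ev.
Qed.

Lemma expFNK t : cancel (expF t) (expF (- t) : H -> H).
Proof. by move=> v; rewrite expFD addNr expF0. Qed.
Lemma expFK t : cancel (expF (- t)) (expF t : H -> H).
Proof. by move=> v; rewrite expFD addrN expF0. Qed.

(** * Derivations twisted by exponentials of F *)

Section TwistedDerivation.
Variables (s t : K) (gx gy : I -> H).

(** [E] and [H] correspond to [s = - h], [t = h]; the cases used below are [s = 0], [t = - h] and
    the ordinary derivations [s = t = 0]. *)
Fixpoint tder_term (a : hterm K I) : H :=
  match a with
  | TX i => gx i
  | TY i => gy i
  | TC _ => 0
  | TA a b => tder_term a + tder_term b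
  | TM a b => tder_term a * expF s (cls h b) + expF t (cls h a) * tder_term b
  end.

Definition tder (v : H) : H := tder_term (rep v).

Hypothesis tder_rel : forall a b, hrel h a b -> tder_term a = tder_term b.

Lemma tder_cong a b : tcong h a b -> tder_term a = tder_term b.
Proof.
elim=> {a b} /=; try by [].
- by move=> a b c _ -> _ ->.
- by move=> a a' b b' _ -> _ ->.
- by move=> a a' b b' /clsP-> -> /clsP-> ->.
- by move=> a b c; rewrite addrA.
- by move=> a b; rewrite addrC.
- by move=> a; rewrite add0r.
- by move=> a b c; rewrite !cls_mul !expFM mulrDl mulrDr !mulrA addrA.
- by move=> a; rewrite expF_const scale1r mul0r mul1r add0r.
- by move=> a; rewrite expF_const scale1r mulr0 mulr1 addr0.
- by move=> a b c; rewrite cls_add linearD /= !mulrDl addrACA.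
- by move=> a b c; rewrite cls_add linearD /= !mulrDr addrACA.
- by move=> a; rewrite expF_const scale0r !mul0r addr0.
- by move=> *; rewrite addr0.
- by move=> *; rewrite mulr0 mul0r addr0.
- by move=> c a; rewrite !expF_const mulr0 mul0r addr0 add0r mulr_algl mulr_algr.
Qed.

Lemma tder_cls a : tder (cls h a) = tder_term a.
Proof. exact/tder_cong/rep_cls. Qed.
Lemma tder_x i : tder (x i) = gx i. Proof. exact: tder_cls. Qed.
Lemma tder_y i : tder (y i) = gy i. Proof. exact: tder_cls. Qed.
Lemma tder_1 : tder 1 = 0. Proof. exact: tder_cls. Qed.
Lemma tderM u v : tder (u * v) = tder u * expF s v + expF t u * tder v.
Proof. by elim/hAlgW: u => a; elim/hAlgW: v => b; rewrite -cls_mul !tder_cls. Qed.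
Lemma tder_linear : linear tder.
Proof.
move=> c; elim/hAlgW => a; elim/hAlgW => b.
rewrite -[c *: _]mulr_algl -cls_const -cls_mul -cls_add !tder_cls /=.
by rewrite mul0r add0r expF_const mulr_algl.
Qed.
End TwistedDerivation.

Section PartialX.
Variable o : I.
(** The twist makes the operator compatible with the relations: for [j != o], both [x j * x o] and
    its reordered form are sent to [x j - h *: y j]. *)
Definition pderx : H -> H := tder 0 (- h) (fun i => (i == o)%:R) (fun=> 0).

Lemma pderx_rel a b : hrel h a b ->
  tder_term 0 (- h) (fun i => (i == o)%:R) (fun=> 0) a =
  tder_term 0 (- h) (fun i => (i == o)%:R) (fun=> 0) b :> H.
Proof.
case=> [i|i j _|i j _|i j _|i j _] /=;
  rewrite ?(cls_mul, expFM, expF_const, expF0) -?/(x _) -?/(y _) ?expF_x ?expF_y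
    ?(mul0r, mulr0, add0r, addr0, cls_const) //.
- by rewrite mulr_natl mulr_natr.
- by rewrite mulr_natl mulr_natr.
- by rewrite mulr_natl mulr_natr.
- case: (i == o); case: (j == o);
  rewrite ?(mul0r, mulr0, add0r, addr0, mul1r, mulr1) // !scaleNr ?mulr_algl //.
  + rewrite mulNr mulr_algl.
    by linear4 (x i) (x j) (y i) (y j).
  + rewrite mulNr mulr_algl.
    by linear4 (x i) (x j) (y i) (y j).
  + by rewrite subrK.
Qed.
End PartialX.
End Relations.

(** * Partial derivatives, degree operators and subalgebras *)

Section NormalForms.
Context (K : numFieldType) (disp : Order.disp_t) (I : orderType disp) (h : K).
Local Notation H := (hAlg I h).
Local Notation x := (hx h).
Local Notation y := (hy h).
Implicit Types (u v w : H) (i j o : I).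
HB.instance Definition _ o :=
  GRing.isLinear.Build K H H _ (pderx o) (tder_linear (@pderx_rel _ _ I h o)).

Lemma pderx_x o i : pderx o (x i) = (i == o)%:R.
Proof. exact: (tder_x (@pderx_rel _ _ I h o)). Qed.
Lemma pderx_y o i : pderx o (y i) = 0.
Proof. exact: (tder_y (@pderx_rel _ _ I h o)). Qed.
Lemma pderx_1 o : pderx o (1 : H) = 0.
Proof. exact: (tder_1 (@pderx_rel _ _ I h o)). Qed.
Lemma pderxM o u v : pderx o (u * v) = pderx o u * v + expF (- h) u * pderx o v.
Proof. by rewrite /pderx (tderM (@pderx_rel _ _ I h o)) expF0. Qed.

(** This derivation multiplies a word by its number of letters with index [j]; its eigenvalues play
    the role of a grading on the quotient algebra. *)
Definition euler j : H -> H :=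
  tder 0 0 (fun i => (i == j)%:R *: x i) (fun i => (i == j)%:R *: y i).

Lemma euler_rel j a b : hrel h a b ->
  tder_term 0 0 (fun i => (i == j)%:R *: x i) (fun i => (i == j)%:R *: y i) a =
  tder_term 0 0 (fun i => (i == j)%:R *: x i) (fun i => (i == j)%:R *: y i) b :> H.
Proof.
have xyl (a' b' : I) : x a' * y b' = y b' * x a' + h *: (y a' * y b') by exact: xyE.
case=> [i|i i' _|i i' _|i i' _|i i' _] /=;
  rewrite ?(cls_mul, expFM, expF_const, expF0) -?/(x _) -?/(y _)
    ?(mul0r, mulr0, add0r, addr0, cls_const, mulr_algl) //;
  rewrite ?(mulrDl, mulrDr) -?scalerAl -?scalerAr -?scalerAl ?xyl ?(yyC h i' i).
- by linear4 (y i * x i) (y i * y i) (1 : H) (1 : H).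
- by linear4 (y i * x i') (y i * y i') (1 : H) (1 : H).
- by linear4 (y i' * x i) (y i * y i') (1 : H) (1 : H).
- by linear4 (y i * y i') (1 : H) (1 : H) (1 : H).
- rewrite (xxE h i i').
  by linear4 (x i * x i') (y i * x i') (y i' * x i) (y i * y i').
Qed.

HB.instance Definition _ j :=
  GRing.isLinear.Build K H H _ (euler j) (tder_linear (@euler_rel j)).

Lemma euler_x j i : euler j (x i) = (i == j)%:R *: x i.
Proof. exact: (tder_x (@euler_rel j)). Qed.
Lemma euler_y j i : euler j (y i) = (i == j)%:R *: y i.
Proof. exact: (tder_y (@euler_rel j)). Qed.
Lemma euler_1 j : euler j (1 : H) = 0.
Proof. exact: (tder_1 (@euler_rel j)). Qed.
Lemma eulerM j u v : euler j (u * v) = euler j u * v + u * euler j v.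
Proof. by rewrite /euler (tderM (@euler_rel j)) !expF0. Qed.

Lemma in_subalg0 (J : I -> Prop) : in_subalg J (0 : H).
Proof. by rewrite -(scale0r (1 : H)); apply/sub_scale/sub_1. Qed.

Lemma in_subalg_sum (J : I -> Prop) (T : Type) (r : seq T) (P : pred T) (F : T -> H) :
  (forall t, P t -> in_subalg J (F t)) -> in_subalg J (\sum_(t <- r | P t) F t).
Proof.
move=> FJ; elim/big_rec: _ => [|t u Pt uJ]; first exact: in_subalg0.
by apply: sub_add => //; apply: FJ.
Qed.

Lemma in_subalg_sub (J J' : I -> Prop) u :
  (forall i, J i -> J' i) -> in_subalg J u -> in_subalg J' u.
Proof.
move=> JJ'; elim=> {u} [i Ji|i Ji||c u _|u v _ uJ _ vJ|u v _ uJ _ vJ].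
- exact/sub_x/JJ'.
- exact/sub_y/JJ'.
- exact: sub_1.
- exact: sub_scale.
- exact: sub_add.
- exact: sub_mul.
Qed.

Lemma in_subalg_expF (J : I -> Prop) t u : in_subalg J u -> in_subalg J (expF t u).
Proof.
elim=> {u} [i Ji|i Ji||c u _ uJ|u v _ uJ _ vJ|u v _ uJ _ vJ].
- by rewrite expF_x; apply: sub_add; [exact: sub_x | apply/sub_scale/sub_y].
- by rewrite expF_y; apply: sub_y.
- by rewrite expF1; apply: sub_1.
- by rewrite linearZ; apply: sub_scale.
- by rewrite linearD; apply: sub_add.
- by rewrite expFM; apply: sub_mul.
Qed.

Lemma in_subalg_opE (J : I -> Prop) u : in_subalg J u -> in_subalg J (opE u).
Proof.
elim=> {u} [i Ji|i Ji||c u _ uJ|u v _ uJ _ vJ|u v uJ EuJ vJ EvJ].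
- by rewrite opE_x; apply: in_subalg0.
- by rewrite opE_y; apply: sub_x.
- by rewrite opE_1; apply: in_subalg0.
- by rewrite linearZ; apply: sub_scale.
- by rewrite linearD; apply: sub_add.
- by rewrite opEM; apply: sub_add; apply: sub_mul => //; apply: in_subalg_expF.
Qed.

Lemma in_subalg_opF (J : I -> Prop) u : in_subalg J u -> in_subalg J (opF u).
Proof.
elim=> {u} [i Ji|i Ji||c u _ uJ|u v _ uJ _ vJ|u v uJ FuJ vJ FvJ].
- by rewrite opF_x; apply: sub_y.
- by rewrite opF_y; apply: in_subalg0.
- by rewrite opF_1; apply: in_subalg0.
- by rewrite linearZ; apply: sub_scale.
- by rewrite linearD; apply: sub_add.
- by rewrite opFM; apply: sub_add; apply: sub_mul.
Qed.

Lemma in_subalg_opH (J : I -> Prop) u : in_subalg J u -> in_subalg J (opH u).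
Proof.
elim=> {u} [i Ji|i Ji||c u _ uJ|u v _ uJ _ vJ|u v uJ HuJ vJ HvJ].
- by rewrite opH_x; apply: sub_x.
- by rewrite opH_y -scaleN1r; apply/sub_scale/sub_y.
- by rewrite opH_1; apply: in_subalg0.
- by rewrite linearZ; apply: sub_scale.
- by rewrite linearD; apply: sub_add.
- by rewrite opHM; apply: sub_add; apply: sub_mul => //; apply: in_subalg_expF.
Qed.

(** * Freeness over the subalgebra without one index *)

Section Freeness.
Variable o : I.
Local Notation Ho := (in_subalg (fun j => j != o)).

Lemma pderx_subalg u : Ho u -> pderx o u = 0.
Proof.
elim=> {u} [i /negPf io|i io||c u _ u0|u v _ u0 _ v0|u v _ u0 _ v0].
- by rewrite pderx_x io.
- by rewrite pderx_y.
- by rewrite pderx_1.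
- by rewrite linearZ /= u0 scaler0.
- by rewrite linearD /= u0 v0 addr0.
- by rewrite pderxM u0 v0 mul0r mulr0 addr0.
Qed.

Lemma pderx_yX b u : pderx o (y o ^+ b * u) = y o ^+ b * pderx o u.
Proof.
elim: b => [|b IH]; first by rewrite !mul1r.
by rewrite exprS -!mulrA pderxM pderx_y mul0r add0r expF_y IH.
Qed.

(** Each application of [pderx o] either removes the factor [x o] or passes it and shifts it by
    [- h *: y o]; [y o] itself is passed unchanged. *)
Lemma iter_pderx_x m u :
  iter m.+1 (pderx o) (x o * u) =
  m.+1%:R *: iter m (pderx o) u + (x o - (m.+1%:R * h) *: y o) * iter m.+1 (pderx o) u.
Proof.
have px v : pderx o (x o * v) = v + (x o - h *: y o) * pderx o v.
  by rewrite pderxM pderx_x eqxx mul1r expF_x scaleNr.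
elim: m => [|m IH]; first by rewrite /= px scale1r mul1r.
rewrite iterS IH linearD linearZ /= mulrBl linearB /= -scalerAl linearZ /= px.
have := pderx_yX 1 (pderx o (iter m (pderx o) u)); rewrite expr1 => ->.
rewrite !mulrBl -!scalerAl -[in RHS]addn1 natrD.
set a := iter m _ u.
set b := pderx o a; set c := x o * _; set d := y o * _; clearbody c d b.
by linear4 b c d (1:H).
Qed.

Lemma iter_pderx_xX m a u : pderx o u = 0 -> (a <= m)%N ->
  iter m (pderx o) (x o ^+ a * u) = if m == a then a`!%:R *: u else 0.
Proof.
move=> u0; have p0 k : iter k.+1 (pderx o) u = 0.
  by elim: k => [|k IH] //; rewrite iterS IH linear0.
elim: a m => [|a IH] [|m] // am; rewrite ?mul1r ?p0 ?scale1r //.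
rewrite exprS -mulrA iter_pderx_x !IH ?(ltnW am) // ?eqSS.
rewrite (gtn_eqF (am : (a < m.+1)%N)) mulr0 addr0.
by case: eqP => [->|_]; rewrite ?scaler0 // factS natrM scalerA.
Qed.

Lemma iter_pderx_yX m b u :
  iter m (pderx o) (y o ^+ b * u) = y o ^+ b * iter m (pderx o) u.
Proof. by elim: m => // m IH; rewrite !iterS IH pderx_yX. Qed.

(** [pderx o] does not detect [y o], but [opE] turns a factor [y o] into [x o], which [pderx o]
    removes. The composite differentiates the power of [y o] and twists the coefficient. *)
Lemma pderx_opE_yX b u : Ho u ->
  pderx o (opE (y o ^+ b * u)) = b%:R *: (y o ^+ b.-1 * expF (- h) u).
Proof.
have eyX k v : expF (- h) (y o ^+ k * v) = y o ^+ k * expF (- h) v.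
  by elim: k => [|k IH]; rewrite ?mul1r // exprS -!mulrA expFM IH expF_y.
move=> uo; elim: b => [|b IH].
  by rewrite mul1r scale0r pderx_subalg //; apply: in_subalg_opE.
rewrite exprS -mulrA opEM opE_y expF_y linearD /= eyX.
have := iter_pderx_x 0 (y o ^+ b * expF (- h) u) => /= ->.
have := pderx_yX 1 (opE (y o ^+ b * u)); rewrite expr1 => ->.
rewrite pderx_yX IH pderx_subalg ?mulr0 ?addr0; last exact: in_subalg_expF.
case: b {IH} => [|b]; first by rewrite scale0r mulr0 addr0.
by rewrite -scalerAr mulrA -exprS -scalerDl -natrD add1n.
Qed.

(** The exponent is lowered by [pderx o \o opE]; the integer factor is nonzero in characteristic
    zero, and the twist [expF (- h)] is injective. *)
Lemma yX_inj b u : Ho u -> y o ^+ b * u = 0 -> u = 0.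
Proof.
elim: b u => [|b IH] u uo; first by rewrite mul1r.
move=> /(congr1 (fun v => pderx o (opE v))); rewrite !linear0 pderx_opE_yX //.
move/eqP; rewrite scaler_eq0 pnatr_eq0 => /eqP/IH u0.
by apply: (can_inj (expFNK (- h))); rewrite linear0 u0 //; apply: in_subalg_expF.
Qed.

(* Applying [pderx o] repeatedly isolates the term of highest degree in [x o]. *)
Lemma free_of_pderx n (g : 'I_n.+1 -> H -> H) (u : 'I_n.+1 -> H) :
  (forall p : 'I_n.+1, g p 0 = 0) ->
  (forall (p : 'I_n.+1) m v, Ho v -> (p <= m)%N ->
     iter m (pderx o) (g p v) = if m == p then p`!%:R *: (y o ^+ (n - p) * v) else 0) ->
  (forall p, Ho (u p)) -> \sum_p g p (u p) = 0 -> forall p, u p = 0.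
Proof.
(* Descending induction on [p], run as strong induction on [n - p]: the coefficients with larger
   index vanish already. *)
move=> g0 gE uo s0 p; move: {2}(n - p)%N (erefl (n - p)%N) => m.
elim/ltn_ind: m p => m IH p mE.
have big (q : 'I_n.+1) : (p < q)%N -> u q = 0.
  move=> pq; apply: (IH (n - q)%N) => //.
  by rewrite -mE ltn_sub2l // (leq_trans pq) // -ltnS.
move: (congr1 (iter p (pderx o)) s0).
have it0 k : iter k (pderx o) (0 : H) = 0 by elim: k => // k; rewrite iterS => ->; rewrite linear0.
have itD k : {morph iter k (pderx o) : a b / a + b : H}.
  by elim: k => // k IHk a b; rewrite !iterS IHk linearD.
rewrite it0 (big_morph _ (itD p) (it0 p)) (bigD1 p) //= big1 ?addr0; last first.
  move=> q qp; have [le_qp|/big ->] := leqP q p; last by rewrite g0 it0.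
  by rewrite gE // (_ : (p == q :> nat) = false) //; apply/negbTE; rewrite eq_sym.
rewrite gE // eqxx => /eqP; rewrite scaler_eq0 pnatr_eq0 -leqn0 leqNgt fact_gt0 /=.
by move=> /eqP/yX_inj ->.
Qed.

Lemma free_yx n (u : 'I_n.+1 -> H) : (forall p, Ho (u p)) ->
  \sum_(p < n.+1) y o ^+ (n - p) * x o ^+ p * u p = 0 -> forall p, u p = 0.
Proof.
move=> uo; under eq_bigr do rewrite -mulrA.
apply: (@free_of_pderx n (fun p v => y o ^+ (n - p) * (x o ^+ p * v))) => //.
  by move=> p; rewrite !mulr0.
move=> p m v /pderx_subalg v0 pm; rewrite iter_pderx_yX iter_pderx_xX //.
by case: eqP; rewrite ?mulr0 // -scalerAr.
Qed.

Lemma free_xy n (u : 'I_n.+1 -> H) : (forall p, Ho (u p)) ->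
  \sum_(p < n.+1) x o ^+ (n - p) * y o ^+ p * u p = 0 -> forall p, u p = 0.
Proof.
(* Here [p] is the exponent of [y o], whereas [free_of_pderx] is indexed by the exponent of [x o];
   hence the reversal. *)
move=> uo s0 p; rewrite -[p]rev_ordK; move: (rev_ord p) => {}p.
apply: (@free_of_pderx n (fun p v => x o ^+ p * (y o ^+ (n - p) * v)) (u \o @rev_ord _)).
- by move=> q; rewrite !mulr0.
- move=> q m v vo qm; rewrite iter_pderx_xX // pderx_yX pderx_subalg ?mulr0 //.
- by move=> q; apply: uo.
rewrite -[RHS]s0 [RHS](reindex_inj rev_ord_inj) /=.
by apply: eq_bigr => q _; rewrite mulrA subSS subKn // -ltnS.
Qed.
End Freeness.
End NormalForms.

(** * Homogeneous elements in one pair of variables *)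

Section WordSpans.
Context (K : numFieldType) (disp : Order.disp_t) (I : orderType disp) (h : K).
Local Notation H := (hAlg I h).
Local Notation x := (hx h).
Local Notation y := (hy h).
Implicit Types (u v w : H) (i j o : I).
(** Homogeneous elements in one pair of variables, with no order imposed on the letters. Growing
    words on the right makes stability under [E], [F], [H] and [expF t] an induction. *)
Inductive word_span o : nat -> H -> Prop :=
| ws_1 : word_span o 0 1
| ws_x n u : word_span o n u -> word_span o n.+1 (u * x o)
| ws_y n u : word_span o n u -> word_span o n.+1 (u * y o)
| ws_scale n c u : word_span o n u -> word_span o n (c *: u)
| ws_add n u v : word_span o n u -> word_span o n v -> word_span o n (u + v).

Lemma ws_mul o m n u v :
  word_span o m u -> word_span o n v -> word_span o (m + n) (u * v).
Proof.
move=> um; elim=> {n v} [|n v _ IH|n v _ IH|n c v _ IH|n v w _ IHv _ IHw].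
- by rewrite addn0 mulr1.
- by rewrite addnS mulrA; apply: ws_x.
- by rewrite addnS mulrA; apply: ws_y.
- by rewrite -scalerAr; apply: ws_scale.
- by rewrite mulrDr; apply: ws_add.
Qed.

Lemma ws_x1 o : word_span o 1 (x o).
Proof. by rewrite -[x o]mul1r; apply/ws_x/ws_1. Qed.
Lemma ws_y1 o : word_span o 1 (y o).
Proof. by rewrite -[y o]mul1r; apply/ws_y/ws_1. Qed.

Lemma ws_xX o n : word_span o n (x o ^+ n).
Proof. by elim: n => [|n IH]; [exact: ws_1 | rewrite exprSr; apply: ws_x]. Qed.
Lemma ws_yX o n : word_span o n (y o ^+ n).
Proof. by elim: n => [|n IH]; [exact: ws_1 | rewrite exprSr; apply: ws_y]. Qed.

Lemma ws_expF o n t u : word_span o n u -> word_span o n (expF t u).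
Proof.
elim=> {n u} [|n v _ IH|n v _ IH|n c v _ IH|n v w _ IHv _ IHw].
- by rewrite expF1; apply: ws_1.
- rewrite expFM expF_x mulrDr -scalerAr.
  by apply: ws_add; [exact: ws_x | apply/ws_scale/ws_y].
- by rewrite expFM expF_y; apply: ws_y.
- by rewrite linearZ; apply: ws_scale.
- by rewrite linearD; apply: ws_add.
Qed.

Lemma ws0 o n : word_span o n 0.
Proof. by rewrite -(scale0r (x o ^+ n)); apply/ws_scale/ws_xX. Qed.

Lemma ws_opF o n u : word_span o n u -> word_span o n (opF u).
Proof.
elim=> {n u} [|n v vn IH|n v vn IH|n c v _ IH|n v w _ IHv _ IHw].
- by rewrite opF_1; apply: ws0.
- by rewrite opFM opF_x; apply: ws_add; [exact: ws_x | exact: ws_y].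
- by rewrite opFM opF_y mulr0 addr0; apply: ws_y.
- by rewrite linearZ; apply: ws_scale.
- by rewrite linearD; apply: ws_add.
Qed.

Lemma ws_opE o n u : word_span o n u -> word_span o n (opE u).
Proof.
elim=> {n u} [|n v vn IH|n v vn IH|n c v _ IH|n v w _ IHv _ IHw].
- by rewrite opE_1; apply: ws0.
- rewrite opEM opE_x expF_x mulr0 addr0 mulrDr -scalerAr.
  by apply: ws_add; [exact: ws_x | apply/ws_scale/ws_y].
- rewrite opEM opE_y expF_y; apply: ws_add; first exact: ws_y.
  by apply/ws_x/ws_expF.
- by rewrite linearZ; apply: ws_scale.
- by rewrite linearD; apply: ws_add.
Qed.

Lemma ws_opH o n u : word_span o n u -> word_span o n (opH u).
Proof.
elim=> {n u} [|n v vn IH|n v vn IH|n c v _ IH|n v w _ IHv _ IHw].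
- by rewrite opH_1; apply: ws0.
- rewrite opHM opH_x expF_x mulrDr -scalerAr; apply: ws_add.
    by apply: ws_add; [exact: ws_x | apply/ws_scale/ws_y].
  by apply/ws_x/ws_expF.
- rewrite opHM opH_y expF_y; apply: ws_add; first exact: ws_y.
  by rewrite mulrN -scaleN1r; apply/ws_scale/ws_y/ws_expF.
- by rewrite linearZ; apply: ws_scale.
- by rewrite linearD; apply: ws_add.
Qed.

Lemma ws_in_subalg o n u : word_span o n u -> in_subalg (fun i => i = o) u.
Proof.
elim=> {n u} [|n v _ IH|n v _ IH|n c v _ IH|n v w _ IHv _ IHw].
- exact: sub_1.
- by apply: sub_mul => //; apply: sub_x.
- by apply: sub_mul => //; apply: sub_y.
- exact: sub_scale.
- exact: sub_add.
Qed.

Lemma yX_x o b : y o ^+ b * x o = x o * y o ^+ b - (b%:R * h) *: y o ^+ b.+1.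
Proof.
elim: b => [|b IH]; first by rewrite mul1r mulr1 mul0r scale0r subr0.
rewrite exprS -[LHS]mulrA IH mulrBr -scalerAr [y o * (x o * _)]mulrA yxE mulrBl mulrBl -!scalerAl -!mulrA -!exprS.
rewrite -natr1; set a := x o * _; set b2 := y o ^+ b.+2; clearbody a b2.
by linear4 a b2 (1:H) (1:H).
Qed.

Section Spanned.
Variables (T0 : finType) (B : T0 -> H).
Definition spanned u := exists c : T0 -> K, u = \sum_p c p *: B p.
Lemma spanned_add u v : spanned u -> spanned v -> spanned (u + v).
Proof.
move=> [c ->] [d ->]; exists (fun p => c p + d p).
by rewrite -big_split; apply: eq_bigr => p _; rewrite scalerDl.
Qed.
Lemma spanned_scale c u : spanned u -> spanned (c *: u).
Proof.
move=> [d ->]; exists (fun p => c * d p).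
by rewrite scaler_sumr; apply: eq_bigr => p _; rewrite scalerA.
Qed.
Lemma spanned_sum (T : Type) (r : seq T) (P : pred T) (F : T -> H) :
  (forall t, P t -> spanned (F t)) -> spanned (\sum_(t <- r | P t) F t).
Proof.
move=> FJ; elim/big_rec: _ => [|t u Pt uJ]; last by apply: spanned_add => //; apply: FJ.
by exists (fun=> 0); rewrite big1 // => p _; rewrite scale0r.
Qed.
Lemma spanned_gen p : spanned (B p).
Proof.
exists (fun q => (q == p)%:R); rewrite (bigD1 p) //= eqxx scale1r big1 ?addr0 //.
by move=> q /negPf ->; rewrite scale0r.
Qed.
End Spanned.

(** Two normal orders occur: [x o] comes first in a form, while [y j] comes first in the expansion
    of the coefficients of a bracket power. *)
Definition xy_basis o n (p : 'I_n.+1) : H := x o ^+ (n - p) * y o ^+ p.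
Definition yx_basis o n (p : 'I_n.+1) : H := y o ^+ (n - p) * x o ^+ p.

Lemma spanned_xy o a b : spanned (xy_basis o (n := a + b)) (x o ^+ a * y o ^+ b).
Proof.
have lt : (b < (a + b).+1)%N by rewrite ltnS leq_addl.
by have := spanned_gen (xy_basis o (n := a + b)) (Ordinal lt); rewrite /xy_basis /= addnK.
Qed.

Lemma spanned_yx o a b : spanned (yx_basis o (n := b + a)) (y o ^+ b * x o ^+ a).
Proof.
have lt : (a < (b + a).+1)%N by rewrite ltnS leq_addl.
by have := spanned_gen (yx_basis o (n := b + a)) (Ordinal lt); rewrite /yx_basis /= addnK.
Qed.

(** Normal ordering: a new letter [x o] on the right is moved past the power of [y o] by [yX_x], at
    the cost of a multiple of the next power of [y o]. *)
Lemma ws_xy_basis o n u : word_span o n u -> spanned (xy_basis o (n := n)) u.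
Proof.
have sum_mul m v w : (forall p, spanned (xy_basis o (n := m.+1)) (xy_basis o (n := m) p * w)) ->
    spanned (xy_basis o (n := m)) v -> spanned (xy_basis o (n := m.+1)) (v * w).
  move=> pw [c ->]; rewrite mulr_suml; apply: spanned_sum => p _.
  by rewrite -scalerAl; apply: spanned_scale.
elim=> {n u} [|n v _ IH|n v _ IH|n c v _ IH|n v w _ IHv _ IHw].
- by have := spanned_xy o 0 0; rewrite mul1r.
- apply: sum_mul IH => p; rewrite /xy_basis -mulrA yX_x mulrBr mulrA -exprSr -scalerAr.
  have pn : (p <= n)%N by rewrite -ltnS.
  apply: spanned_add.
    by have := spanned_xy o (n - p).+1 p; rewrite addSn subnK.
  rewrite -scaleNr; apply: spanned_scale.
  by have := spanned_xy o (n - p) p.+1; rewrite addnS subnK.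
- apply: sum_mul IH => p; rewrite /xy_basis -mulrA -exprSr.
  by have := spanned_xy o (n - p) p.+1; rewrite addnS subnK // -ltnS.
- exact: spanned_scale.
- exact: spanned_add.
Qed.

Lemma x_yx_basis o a b : x o * (y o ^+ b * x o ^+ a) =
  y o ^+ b * x o ^+ a.+1 + (b%:R * h) *: (y o ^+ b.+1 * x o ^+ a).
Proof.
have := yX_x o b; rewrite mulrA => /eqP; rewrite eq_sym subr_eq => /eqP ->.
by rewrite mulrDl -mulrA -exprS -scalerAl.
Qed.

(** Reduced to the other normal order: the powers of [x o] are multiplied one by one from the left
    onto a power of [y o]. *)
Lemma ws_yx_basis o n u : word_span o n u -> spanned (yx_basis o (n := n)) u.
Proof.
have xmul m v : spanned (yx_basis o (n := m)) v -> spanned (yx_basis o (n := m.+1)) (x o * v).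
  move=> [c ->]; rewrite mulr_sumr; apply: spanned_sum => p _.
  have pm : (p <= m)%N by rewrite -ltnS.
  rewrite -scalerAr; apply: spanned_scale; rewrite x_yx_basis; apply: spanned_add.
    by have := spanned_yx o p.+1 (m - p); rewrite addnS subnK.
  by apply: spanned_scale; have := spanned_yx o p (m - p).+1; rewrite addSn subnK.
move=> /ws_xy_basis[c ->]; apply: spanned_sum => p _; apply: spanned_scale.
have pn : (p <= n)%N by rewrite -ltnS.
suff main a b : spanned (yx_basis o (n := a + b)) (x o ^+ a * y o ^+ b).
  by have := main (n - p)%N p; rewrite subnK.
elim: a => [|a IH]; last by rewrite exprS -mulrA; apply: xmul.
by have := spanned_yx o 0 b; rewrite addn0 mulr1 mul1r.
Qed.
End WordSpans.

(** * Invariant forms *)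

Section InvariantForms.
Context (K : numFieldType) (disp : Order.disp_t) (I : orderType disp) (h : K).
Local Notation H := (hAlg I h).
Local Notation x := (hx h).
Local Notation y := (hy h).
Implicit Types u v w : H.
Section Forms.
Variables (o : I) (n : nat).
Implicit Types i l p : 'I_n.+1.
Local Notation Ho := (in_subalg (fun j => j != o)).
Definition bxy (i : 'I_n.+1) : H := 'C(n, i)%:R *: xy_basis h o i.

Lemma bin_neq0 (i : 'I_n.+1) : 'C(n, i)%:R != 0 :> K.
Proof. by rewrite pnatr_eq0 -lt0n bin_gt0 -ltnS. Qed.

Lemma free_bxy (u : 'I_n.+1 -> H) : (forall i, Ho (u i)) ->
  \sum_i bxy i * u i = 0 -> forall i, u i = 0.
Proof.
move=> uo s0 i; apply/eqP.
have /(_ i)/eqP : forall i : 'I_n.+1, 'C(n, i)%:R *: u i = 0.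
  apply: (@free_xy _ _ _ h o n); first by move=> j; apply: sub_scale.
  by rewrite -[RHS]s0; apply: eq_bigr => j _; rewrite -scalerAr scalerAl.
by rewrite scaler_eq0 (negPf (bin_neq0 i)).
Qed.

(** Comparison of coefficients, which turns an identity for an invariant form into identities for
    its coefficients. *)
Lemma bxy_eq (u v : 'I_n.+1 -> H) : (forall i, Ho (u i)) -> (forall i, Ho (v i)) ->
  \sum_i bxy i * u i = \sum_i bxy i * v i -> forall i, u i = v i.
Proof.
move=> uo vo /eqP; rewrite -subr_eq0 => /eqP uv i; apply/eqP.
rewrite -subr_eq0; apply/eqP; move: i; apply: free_bxy.
  by move=> i; rewrite -scaleN1r; apply: sub_add => //; apply: sub_scale.
by rewrite -[RHS]uv -sumrB; apply: eq_bigr => i _; rewrite mulrBr.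
Qed.

Lemma ws_bxy i : word_span o n (bxy i).
Proof.
have i_n : (i <= n)%N by rewrite -ltnS.
by apply: ws_scale; rewrite -{1}(subnK i_n); apply: ws_mul; [exact: ws_xX | exact: ws_yX].
Qed.

Lemma ws_spanned_bxy u : word_span o n u -> spanned bxy u.
Proof.
move=> /ws_xy_basis[c ->]; exists (fun i => c i / 'C(n, i)%:R).
by apply: eq_bigr => i _; rewrite scalerA divfK // bin_neq0.
Qed.

Lemma bxy_op (D : H -> H) : (forall u, word_span o n u -> word_span o n (D u)) ->
  exists c : 'I_n.+1 -> 'I_n.+1 -> K, forall i, D (bxy i) = \sum_l c i l *: bxy l.
Proof.
move=> Dn; suff /choice[c cP] : forall i, spanned bxy (D (bxy i)) by exists c.
by move=> i; apply/ws_spanned_bxy/Dn/ws_bxy.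
Qed.

Lemma exchange_bxy (c : 'I_n.+1 -> 'I_n.+1 -> K) (u : 'I_n.+1 -> H) :
  \sum_i (\sum_l c i l *: bxy l) * u i = \sum_l bxy l * \sum_i c i l *: u i.
Proof.
under eq_bigr do rewrite mulr_suml; rewrite exchange_big; apply: eq_bigr => l _.
by rewrite mulr_sumr; apply: eq_bigr => i _; rewrite -scalerAl scalerAr.
Qed.

(* [D] acts on the coefficients of every invariant form of degree [n] through
   one and the same matrix. *)
Definition universal (D : H -> H) := exists c : 'I_n.+1 -> 'I_n.+1 -> K,
  forall A : 'I_n.+1 -> H, (forall i, Ho (A i)) ->
    is_invariant (\sum_i bxy i * A i) -> forall l, D (A l) = \sum_i c i l *: A i.

Lemma expF_fixed t u : opF u = 0 -> expF t u = u.
Proof.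
by move=> u0; rewrite (@expF_sum _ _ _ _ t u 1) //= big_ord1 expr0 divr1 scale1r.
Qed.

Lemma Ho_comb (c : 'I_n.+1 -> K) (A : 'I_n.+1 -> H) :
  (forall i, Ho (A i)) -> Ho (\sum_i c i *: A i).
Proof. by move=> Ao; apply: in_subalg_sum => i _; apply: sub_scale. Qed.

(** An invariant form is fixed by the multiplicative map [expF (- t)]. Comparing coefficients
    expresses [A l] through the [expF (- t) (A i)], and [expF t] inverts this. *)
Lemma universal_expF t : universal (expF t).
Proof.
have [c cP] := bxy_op (@ws_expF _ _ _ _ _ _ (- t)).
exists c => A Ao [_ f0 _] l.
suff -> : A l = \sum_i c i l *: expF (- t) (A i).
  by rewrite linear_sum; apply: eq_bigr => i _; rewrite linearZ /= expFK.
move: l; apply: bxy_eq => //.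
  by move=> i; apply: Ho_comb => j; apply: in_subalg_expF.
rewrite -[LHS](expF_fixed (- t) f0) linear_sum -exchange_bxy.
by apply: eq_bigr => i _; rewrite /= expFM cP.
Qed.

Lemma universal_opF : universal (@opF _ _ I h).
Proof.
have [c cP] := bxy_op (@ws_opF _ _ _ _ _ _).
exists (fun i l => - c i l) => A Ao [_ f0 _].
apply: bxy_eq; first by move=> l; apply: in_subalg_opF.
  by move=> l; apply: Ho_comb.
under [RHS]eq_bigr do under eq_bigr do rewrite scaleNr.
under [RHS]eq_bigr do rewrite sumrN mulrN.
rewrite sumrN -exchange_bxy; apply/eqP; rewrite -addr_eq0 -big_split -[eqbRHS]f0.
rewrite linear_sum; apply/eqP/eq_bigr => i _.
by rewrite /= opFM cP addrC.
Qed.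

(** In [D f = 0] the monomials in front of [D (A i)] carry the twist [expF h]; applying [expF (- h)]
    removes it, so that coefficients can be compared. Undoing this twist leaves the
    [expF (- h) (A i)], which [universal_expF] expresses through the [A p]. *)
Lemma universal_skew (D : {linear H -> H}) :
  (forall u v, D (u * v) = D u * expF (- h) v + expF h u * D v) ->
  (forall u, word_span o n u -> word_span o n (D u)) ->
  (forall u, Ho u -> Ho (D u)) ->
  (forall u, is_invariant u -> D u = 0) -> universal D.
Proof.
move=> DM Dn Do D0.
have [c cP] := bxy_op (fun u un => @ws_expF _ _ _ _ _ _ (- h) _ (Dn u un)).
have [e eP] := universal_expF (- h).
exists (fun p l => - \sum_i c i l * e p i) => A Ao f0.
have eA l : expF (- h) (D (A l)) = \sum_i - c i l *: expF (- h - h) (A i).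
  move: l; apply: bxy_eq.
  - by move=> l; apply/in_subalg_expF/Do.
  - by move=> l; apply: Ho_comb => i; apply: in_subalg_expF.
  under [RHS]eq_bigr do under eq_bigr do rewrite scaleNr.
  under [RHS]eq_bigr do rewrite sumrN mulrN.
  rewrite sumrN -exchange_bxy; apply/eqP; rewrite -addr_eq0 -big_split; apply/eqP.
  transitivity (expF (- h) (D (\sum_i bxy i * A i))); last by rewrite D0 // linear0.
  rewrite !linear_sum; apply: eq_bigr => i _.
  by rewrite /= DM linearD /= !expFM -cP expFNK expFD addrC.
move=> l; rewrite -[LHS](expFK h) eA linear_sum.
under eq_bigr do rewrite /= linearZ /= expFD addrA subrr add0r (eP _ Ao f0).
under eq_bigr do rewrite scaleNr scaler_sumr.
rewrite sumrN exchange_big -sumrN; apply: eq_bigr => p _.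
rewrite scaleNr scaler_suml; congr (- _); apply: eq_bigr => i _.
by rewrite scalerA.
Qed.

Lemma universal_opE : universal (@opE _ _ I h).
Proof.
apply: universal_skew; first exact: opEM.
- by move=> u; apply: ws_opE.
- by move=> u; apply: in_subalg_opE.
- by move=> u [].
Qed.

Lemma universal_opH : universal (@opH _ _ I h).
Proof.
apply: universal_skew; first exact: opHM.
- by move=> u; apply: ws_opH.
- by move=> u; apply: in_subalg_opH.
- by move=> u [].
Qed.
End Forms.
End InvariantForms.

(** * Powers of the bracket *)

Section Brackets.
Context (K : numFieldType) (disp : Order.disp_t) (I : orderType disp) (h : K).
Local Notation H := (hAlg I h).
Local Notation x := (hx h).
Local Notation y := (hy h).
Implicit Types u v w : H.
Lemma invariantM u v : is_invariant u -> is_invariant v -> is_invariant (u * v).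
Proof.
move=> [Eu Fu Hu] [Ev Fv Hv].
by split; rewrite ?(opEM, opFM, opHM) ?(Eu, Fu, Hu, Ev, Fv, Hv) mul0r mulr0 addr0.
Qed.

Lemma invariant1 : is_invariant (1 : H).
Proof. by split; [exact: opE_1 | exact: opF_1 | exact: opH_1]. Qed.

Lemma invariantX u n : is_invariant u -> is_invariant (u ^+ n).
Proof.
move=> u0; elim: n => [|n IH]; first exact: invariant1.
by rewrite exprS; apply: invariantM.
Qed.

Section Bracket.
Variables o j : I.
Local Notation b := (bracket h o j).

Lemma invariant_bracket : is_invariant b.
Proof.
split; rewrite /bracket !linearB linearZ /=.
- rewrite !opEM !opE_x !opE_y ?expF_x ?expF_y !(mul0r, mulr0, add0r, addr0).
  rewrite !mulrDl !mulrDr -!scalerAl -!scalerAr.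
  by linear4 (x o * x j) (x o * y j) (y o * x j) (1 : H).
- by rewrite !opFM !opF_x !opF_y !(mul0r, mulr0, add0r, addr0) subrr scaler0 subr0.
- rewrite !opHM !opH_x !opH_y ?expF_x ?expF_y.
  rewrite !mulrDl !mulrDr !mulrN !mulNr -!scalerAl -!scalerAr.
  by linear4 (x o * y j) (y o * x j) (y o * y j) (1 : H).
Qed.

(** Together with [bracket_xC] this lets a bracket pass the coefficients of its own powers, which
    are built from [x j] and [y j]. *)
Lemma bracket_yC : b * y j = y j * b.
Proof.
rewrite /bracket !mulrBl !mulrBr -scalerAl -scalerAr !mulrA.
rewrite (yxE h o j) (yyC h j o) mulrBl -scalerAl.
rewrite -[y o * x j * y j]mulrA (xyE h j j) mulrDr -scalerAr !mulrA mulrBl -scalerAl.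
by linear4 (x o * y j * y j) (y o * y j * x j) (y o * y j * y j) (1 : H).
Qed.

Lemma bracket_xC : b * x j = x j * b.
Proof.
rewrite /bracket !mulrBl !mulrBr -scalerAl -scalerAr !mulrA.
have yxy : y j * x o * y j = y j * y j * x o + h *: (y o * y j * y j).
  by rewrite -mulrA (xyE h o j) mulrDr -scalerAr !mulrA (yyC h j o).
have xyy : x o * y j * y j = y j * y j * x o + (h + h) *: (y o * y j * y j).
  by rewrite {1}(xyE h o j) mulrDl yxy -scalerAl -addrA -scalerDl.
rewrite (xxE h o j) (xyE h j o) !mulrBl !mulrDl -?scalerAl.
rewrite -[x o * x j * y j]mulrA -[y o * x j * y j]mulrA (xyE h j j) !mulrDr -?scalerAr.
rewrite !mulrA yxy xyy (yyC h j o) -!addrA; congr (_ + _).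
by linear4 (y o * x j * x j) (y o * y j * x j) (y j * y j * x o) (y o * y j * y j).
Qed.

(** Moving [y o ^+ i] past [x o] contributes [i] multiples of [h]; the last term of the bracket
    contributes one more, whence [i.+1]. *)
Lemma yX_bracket i v : y o ^+ i * (b * v) =
  x o * y o ^+ i * (y j * v) - y o ^+ i.+1 * ((x j + (i.+1%:R * h) *: y j) * v).
Proof.
rewrite /bracket !mulrBl !mulrBr -scalerAl -scalerAr !mulrA yX_x -exprSr.
rewrite mulrDr !mulrBl mulrDl -?scalerAr -?scalerAl -natr1.
set p := x o * _ * _ * _; set q := y o ^+ i.+1 * _ * _; set r := y o ^+ i.+1 * _ * _.
clearbody p q r.
by linear4 p q r (1 : H).
Qed.
End Bracket.
End Brackets.

(** * Coefficients of the powers of the bracket *)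

Section BracketPowers.
Context (K : numFieldType) (disp : Order.disp_t) (I : orderType disp) (h : K).
Local Notation H := (hAlg I h).
Local Notation x := (hx h).
Local Notation y := (hy h).
Implicit Types u v w : H.
(* The entry [(i, p)] is the coordinate of [binomial n i *: A_i] at
   [y_j ^+ (n - p) * x_j ^+ p], where the [A_i] are the coefficients of [(0j)^n]. *)
Fixpoint bracket_coef (n i p : nat) : K :=
  match n, i with
  | 0, _ => ((i == 0) && (p == 0))%:R
  | n'.+1, 0 => bracket_coef n' 0 p
  | n'.+1, i'.+1 => bracket_coef n' i p
      - (if p is p'.+1 then bracket_coef n' i' p' else 0)
      - ((n' - p)%:R + i%:R) * h * bracket_coef n' i' p
  end.

(** The case [i < p] is the triangularity of the coefficient matrix. *)
Lemma bracket_coef_eq0 n i p : (i < p)%N || (n < i)%N -> bracket_coef n i p = 0.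
Proof.
elim: n i p => [|n IH] [|i] [|p] //= lt; rewrite ?IH ?mulr0 ?subr0 //; move: lt.
- by rewrite !ltnS => /ltnW.
- by rewrite !ltnS => /orP[/ltnW|] ->; rewrite ?orbT.
- by rewrite !ltnS => /orP[->|/ltnW ->]; rewrite ?orbT.
Qed.

(** On the diagonal the term in [h] vanishes by triangularity, and Pascal's rule remains. *)
Lemma bracket_coef_diag n i : bracket_coef n i i = (-1) ^+ i * 'C(n, i)%:R.
Proof.
elim: n i => [|n IH] [|i] /=; rewrite ?mulr0 ?mulr1 //.
  by rewrite IH bin0 mulr1.
rewrite !IH (@bracket_coef_eq0 n i i.+1) ?ltnSn // mulr0 subr0 binS natrD mulrDr.
by rewrite exprS mulN1r !mulNr.
Qed.

Section BracketExpansion.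
Variables o j : I.
Local Notation b := (bracket h o j).

Definition bracket_form (n i : nat) : H :=
  \sum_(p < n.+1) bracket_coef n i p *: (y j ^+ (n - p) * x j ^+ p).

Lemma bracket_form_gt n i : (n < i)%N -> bracket_form n i = 0.
Proof.
move=> ni; rewrite /bracket_form big1 // => p _.
by rewrite bracket_coef_eq0 ?scale0r // ni orbT.
Qed.

Lemma bracket_form_y n i : y j * bracket_form n i =
  \sum_(p < n.+2) bracket_coef n i p *: (y j ^+ (n.+1 - p) * x j ^+ p).
Proof.
rewrite big_ord_recr /= [bracket_coef n i n.+1]bracket_coef_eq0; last first.
  by rewrite ltnS leqNgt orNb.
rewrite scale0r addr0 mulr_sumr; apply: eq_bigr => p _.
by rewrite -scalerAr mulrA -exprS subSn // -ltnS.
Qed.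

Lemma bracket_form0 n : bracket_form n.+1 0 = y j * bracket_form n 0.
Proof. by rewrite bracket_form_y. Qed.

(** Normal ordering of [x j] times a monomial produces the summand [(n - p) h] of the recursion for
    [bracket_coef]; the other summand is the shift [i.+1 * h] of [yX_bracket]. *)
Lemma bracket_formS n i : bracket_form n.+1 i.+1 =
  y j * bracket_form n i.+1 - (x j + (i.+1%:R * h) *: y j) * bracket_form n i.
Proof.
pose c p := if p is p'.+1 then bracket_coef n i p' else 0.
have xE : x j * bracket_form n i =
    \sum_(p < n.+2) c p *: (y j ^+ (n.+1 - p) * x j ^+ p)
    + \sum_(p < n.+2) ((n - p)%:R * h * bracket_coef n i p) *:
        (y j ^+ (n.+1 - p) * x j ^+ p).
  rewrite big_ord_recl scale0r add0r [X in _ + X]big_ord_recr /= subnn.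
  (* The extra last term has the factor [n - n.+1], which is [0] by truncated subtraction. *)
  rewrite (eqP (_ : (n - n.+1)%N == 0)) ?subn_eq0 ?leqnSn // !mul0r scale0r addr0 -big_split.
  rewrite mulr_sumr; apply: eq_bigr => p _; rewrite /= /bump add1n subSS.
  rewrite -scalerAr x_yx_basis scalerDr scalerA subSn ?[_ * (_ * h)]mulrC //.
  by rewrite -ltnS.
rewrite mulrDl -scalerAl xE !bracket_form_y scaler_sumr -!big_split -sumrB.
apply: eq_bigr => p _; rewrite /= -/(c p) scalerA -!scalerDl -scalerBl; congr (_ *: _).
by move: (bracket_coef _ _ _) (c p) (bracket_coef _ _ _) => *; ring.
Qed.

Lemma bracket_formC n i : bracket_form n i * b = b * bracket_form n i.
Proof.
have XC m u : b * u = u * b -> b * u ^+ m = u ^+ m * b.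
  by move=> ub; apply: commrX.
rewrite mulr_suml mulr_sumr; apply: eq_bigr => p _.
rewrite -scalerAl -scalerAr -mulrA -(XC _ _ (bracket_xC _ _ _)) mulrA.
by rewrite -(XC _ _ (bracket_yC _ _ _)) mulrA.
Qed.

Lemma bracketX n :
  b ^+ n = \sum_(i < n.+1) x o ^+ (n - i) * y o ^+ i * bracket_form n i.
Proof.
elim: n => [|n IH].
  by rewrite big_ord1 /bracket_form big_ord1 /= scale1r !mulr1.
(* The two parts of [yX_bracket]: [t i] keeps the exponent of [y o] and [s i] raises it, so [s i]
   belongs to the coefficient with index [i.+1]. *)
pose t i := x o ^+ (n.+1 - i) * y o ^+ i * (y j * bracket_form n i).
pose s i := x o ^+ (n - i) * y o ^+ i.+1 *
  ((x j + (i.+1%:R * h) *: y j) * bracket_form n i).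
transitivity (\sum_(i < n.+1) (t i - s i)).
  rewrite exprSr IH mulr_suml; apply: eq_bigr => i _.
  rewrite -!mulrA bracket_formC yX_bracket mulrBr !mulrA -exprSr -subSn; last by rewrite -ltnS.
  by rewrite /t /s !mulrA.
rewrite sumrB [RHS]big_ord_recl /= bracket_form0 -/(t 0).
under [in RHS]eq_bigr => i _.
  rewrite bracket_formS mulrBr /bump add1n subSS -/(s i).
  rewrite -[X in X - _]/(t i.+1).
  over.
rewrite sumrB addrA; congr (_ - _).
rewrite -(big_ord_recl n.+1 (fun i => t i)) [RHS]big_ord_recr /=.
by rewrite [t n.+1]/t bracket_form_gt // !mulr0 addr0.
Qed.
End BracketExpansion.
End BracketPowers.

(** * Transfer from the special forms *)

Section Transfer.
Context (K : numFieldType) (disp : Order.disp_t) (I : orderType disp) (h : K).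
Local Notation H := (hAlg I h).
Local Notation x := (hx h).
Local Notation y := (hy h).
Implicit Types u v w : H.
Lemma form_expansion_bxy o n (A : 'I_n.+1 -> H) f :
  form_expansion o A f -> f = \sum_i bxy h o i * A i.
Proof. by case=> _ ->; apply: eq_bigr => i _; rewrite -scalerAl. Qed.

(** * Coefficients of a special form as a basis *)

Section SpecialForms.
Variables (o j : I) (n : nat) (A : 'I_n.+1 -> H).
Hypotheses (jo : j != o) (Aexp : form_expansion o A (bracket h o j ^+ n)).

Lemma ws_yx p : word_span j n (yx_basis h j (n := n) p).
Proof.
have pn : (p <= n)%N by rewrite -ltnS.
by rewrite -{1}(subnK pn); apply: ws_mul; [exact: ws_yX | exact: ws_xX].
Qed.

(** Dividing by the binomial coefficient makes the diagonal entries signs, so the triangular matrix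
    is invertible; the [A i] are identified by comparison of coefficients. *)
Lemma bracket_matrix : exists2 N : 'M[K]_n.+1, N \in unitmx &
  forall i, A i = \sum_p N i p *: yx_basis h j p.
Proof.
pose N := \matrix_(i < n.+1, p < n.+1) ('C(n, i)%:R^-1 * bracket_coef h n i p).
have NE i : \sum_p N i p *: yx_basis h j p = 'C(n, i)%:R^-1 *: bracket_form h j n i.
  by rewrite scaler_sumr; apply: eq_bigr => p _; rewrite mxE scalerA.
exists N.
  rewrite unitmxE det_trig; last first.
    by apply/is_trig_mxP => i p ip; rewrite mxE bracket_coef_eq0 ?mulr0 // ip.
  rewrite unitfE; apply/prodf_neq0 => i _.
  by rewrite mxE bracket_coef_diag mulrCA mulVf ?bin_neq0 // mulr1 signr_eq0.
move=> i; rewrite NE; move: i; apply: (@bxy_eq _ _ _ _ o).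
- by case: Aexp.
- move=> i; apply/sub_scale/in_subalg_sum => p _; apply/sub_scale.
  by apply: in_subalg_sub (ws_in_subalg (ws_yx p)) => _ ->.
rewrite -(form_expansion_bxy Aexp) bracketX; apply: eq_bigr => i _.
by rewrite -scalerAr -scalerAl scalerA mulVf ?bin_neq0 // scale1r.
Qed.

Lemma ws_special i : word_span j n (A i).
Proof.
have [N _ ->] := bracket_matrix; elim/big_rec: _ => [|p u _ un]; first exact: ws0.
by apply: ws_add => //; apply/ws_scale/ws_yx.
Qed.

Lemma special_spans u : word_span j n u -> spanned A u.
Proof.
move=> /ws_yx_basis[c ->]; have [N Nu AE] := bracket_matrix.
apply: spanned_sum => p _; apply: spanned_scale; exists (invmx N p).
have invE q : \sum_i invmx N p i * N i q = (p == q)%:R.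
  by have /matrixP/(_ p q) := mulVmx Nu; rewrite !mxE.
under eq_bigr do rewrite AE scaler_sumr; rewrite exchange_big /=.
under eq_bigr => q _.
  by under eq_bigr do rewrite scalerA; rewrite -scaler_suml invE; over.
by rewrite (bigD1 p) //= eqxx scale1r big1 ?addr0 // => q; rewrite eq_sym => /negPf ->; rewrite scale0r.
Qed.

(** Collecting the terms at each [y j ^+ (n - p) * x j ^+ p] gives a linear system for the [u i] by
    [free_yx]; the inverse matrix solves it. *)
Lemma special_free (u : 'I_n.+1 -> H) :
  (forall i, in_subalg (fun i => i != j) (u i)) ->
  \sum_i A i * u i = 0 -> forall i, u i = 0.
Proof.
move=> uj s0; have [N Nu AE] := bracket_matrix.
have Nu0 p : \sum_i N i p *: u i = 0.
  move: p; apply: (@free_yx _ _ _ h j n).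
    by move=> p; apply: in_subalg_sum => i _; apply: sub_scale.
  rewrite -[RHS]s0; under [RHS]eq_bigr do rewrite AE mulr_suml.
  rewrite exchange_big; apply: eq_bigr => p _; rewrite mulr_sumr.
  by apply: eq_bigr => i _; rewrite -scalerAl -scalerAr.
move=> q; transitivity (\sum_i (N *m invmx N) i q *: u i).
  by rewrite mulmxV // (bigD1 q) //= mxE eqxx scale1r big1 ?addr0 // => i /negPf iq;
    rewrite mxE iq scale0r.
under eq_bigr do rewrite mxE scaler_suml.
rewrite exchange_big big1 //= => p _.
under eq_bigr do rewrite mulrC -scalerA.
by rewrite -scaler_sumr Nu0 scaler0.
Qed.
End SpecialForms.

(** * Parallel combinations of words in two families *)

Section Twin.
Variables (k n : nat) (J : 'I_k -> I).
Implicit Types (s : seq 'I_k) (B C : 'I_k -> 'I_n.+1 -> H).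

(* [twin B C s u v]: [u] and [v] are the same linear combination of the words
   indexed by [s] in the coefficients [B] and [C] respectively. *)
Inductive twin B C : seq 'I_k -> H -> H -> Prop :=
| twin_nil c : twin B C [::] c%:A c%:A
| twin_cons j s (u v : 'I_n.+1 -> H) : (forall i, twin B C s (u i) (v i)) ->
    twin B C (j :: s) (\sum_i B j i * u i) (\sum_i C j i * v i).

Lemma twin_add B C s u v u' v' :
  twin B C s u v -> twin B C s u' v' -> twin B C s (u + u') (v + v').
Proof.
move=> uv; elim: uv u' v' => {s u v} [c|j s u v _ IH] u' v' uv'; inversion uv' as [c' E|j' s' p q pq E].
  by rewrite -!scalerDl; apply: twin_nil.
rewrite -!big_split /=.
under eq_bigr do rewrite -mulrDr; under [X in twin _ _ _ _ X]eq_bigr do rewrite -mulrDr.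
by apply: twin_cons => i; apply: IH.
Qed.

Lemma twin_scale B C s c u v : twin B C s u v -> twin B C s (c *: u) (c *: v).
Proof.
elim=> {s u v} [d|j s u v _ IH]; first by rewrite !scalerA; apply: twin_nil.
rewrite !scaler_sumr.
under eq_bigr do rewrite scalerAr; under [X in twin _ _ _ _ X]eq_bigr do rewrite scalerAr.
exact: twin_cons.
Qed.

Lemma twin0 B C s : twin B C s 0 0.
Proof.
elim: s => [|j s IH]; first by rewrite -(scale0r (1 : H)); apply: twin_nil.
have := twin_cons j (fun=> IH); rewrite !big1 // => i _; exact: mulr0.
Qed.

Lemma twin_sum B C s (T : Type) (r : seq T) (P : pred T) (u v : T -> H) :
  (forall t, P t -> twin B C s (u t) (v t)) ->
  twin B C s (\sum_(t <- r | P t) u t) (\sum_(t <- r | P t) v t).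
Proof.
by move=> uv; elim/big_rec2: _ => [|t a b Pt ab]; [exact: twin0 | apply: twin_add => //; apply: uv].
Qed.

Lemma twin_mul B C j s i u v : twin B C s u v -> twin B C (j :: s) (B j i * u) (C j i * v).
Proof.
move=> uv.
have := @twin_cons B C j s (fun l => (l == i)%:R *: u) (fun l => (l == i)%:R *: v).
rewrite !(bigD1 i (P := xpredT)) //= eqxx !scale1r !big1 ?addr0; first last.
- by move=> l /negPf ->; rewrite scale0r mulr0.
- by move=> l /negPf ->; rewrite scale0r mulr0.
by apply=> l; apply: twin_scale.
Qed.

Lemma twin_prod B C s (m : 'I_k -> 'I_n.+1) :
  twin B C s (\prod_(j <- s) B j (m j)) (\prod_(j <- s) C j (m j)).
Proof.
elim: s => [|j s IH]; last by rewrite !big_cons; apply: twin_mul.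
by rewrite !big_nil -[1]scale1r; apply: twin_nil.
Qed.

Lemma twin_multilinear B C (c : {ffun {ffun 'I_k -> 'I_n.+1} -> K}) :
  twin B C (index_enum 'I_k) (multilinear_expr c B) (multilinear_expr c C).
Proof. by apply: twin_sum => m _; apply/twin_scale/twin_prod. Qed.

Definition same_action B C (D : H -> H) := forall j, exists c : 'I_n.+1 -> 'I_n.+1 -> K,
  forall i, D (B j i) = \sum_l c i l *: B j l /\ D (C j i) = \sum_l c i l *: C j l.

Lemma twin_word B C j s c u v : twin B C s u v ->
  twin B C (j :: s) ((\sum_l c l *: B j l) * u) ((\sum_l c l *: C j l) * v).
Proof.
move=> uv; rewrite !mulr_suml; apply: twin_sum => l _.
by rewrite -!scalerAl; apply/twin_scale/twin_mul.
Qed.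

Lemma twin_expF B C t s u v : same_action B C (expF t) ->
  twin B C s u v -> twin B C s (expF t u) (expF t v).
Proof.
move=> DBC; elim=> {s u v} [c|j s u v _ IH].
  by rewrite linearZ /= expF1; apply: twin_nil.
have [c cE] := DBC j; rewrite !linear_sum; apply: twin_sum => i _ /=.
by rewrite !expFM !(proj1 (cE i)) !(proj2 (cE i)); apply: twin_word.
Qed.

Lemma twin_opF B C s u v : same_action B C (@opF _ _ I h) ->
  twin B C s u v -> twin B C s (opF u) (opF v).
Proof.
move=> DBC; elim=> {s u v} [c|j s u v uv IH].
  by rewrite linearZ /= opF_1 scaler0; apply: twin0.
have [c cE] := DBC j; rewrite !linear_sum; apply: twin_sum => i _ /=.
rewrite !opFM !(proj1 (cE i)) !(proj2 (cE i)).
by apply: twin_add; [apply: twin_word | apply: twin_mul].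
Qed.

(** The twisted Leibniz rule applies [expF h] to the first letter and [expF (- h)] to the remaining
    word, hence the common action of the exponentials is required besides that of [D]. *)
Lemma twin_skew B C (D : {linear H -> H}) s u v :
  D 1 = 0 -> (forall a b, D (a * b) = D a * expF (- h) b + expF h a * D b) ->
  (forall t, same_action B C (expF t)) -> same_action B C D ->
  twin B C s u v -> twin B C s (D u) (D v).
Proof.
move=> D1 DM eBC DBC; elim=> {s u v} [c|j s u v uv IH].
  by rewrite linearZ /= D1 scaler0; apply: twin0.
have [c cE] := DBC j; have [e eE] := eBC h j; rewrite !linear_sum; apply: twin_sum => i _ /=.
rewrite !DM !(proj1 (cE i)) !(proj2 (cE i)) !(proj1 (eE i)) !(proj2 (eE i)).
by apply: twin_add; apply: twin_word => //; apply: twin_expF.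
Qed.

Definition free_family B := forall j (u : 'I_n.+1 -> H),
  (forall i, in_subalg (fun a => a != J j) (u i)) ->
  \sum_i B j i * u i = 0 -> forall i, u i = 0.

Lemma twin_in_subalg B C s u v : (forall j i, in_subalg (fun a => a = J j) (B j i)) ->
  twin B C s u v -> in_subalg (fun a => exists2 j, j \in s & a = J j) u.
Proof.
move=> BJ; elim=> {s u v} [c|j s u v _ IH]; first exact/sub_scale/sub_1.
apply: in_subalg_sum => i _; apply: sub_mul.
  by apply: in_subalg_sub (BJ j i) => a ->; exists j => //; rewrite mem_head.
by apply: in_subalg_sub (IH i) => a [j' j's ->]; exists j' => //; rewrite inE j's orbT.
Qed.

(** The first letter is peeled off: the rest of the word involves other indices only, so freeness of
    [B j] makes every [u i] vanish, and by induction every [v i]. Thus a relation in [B] passes to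
    any family [C]. *)
Lemma twin_eq0 B C s u v : injective J -> uniq s ->
  (forall j i, in_subalg (fun a => a = J j) (B j i)) -> free_family B ->
  twin B C s u v -> u = 0 -> v = 0.
Proof.
move=> Jinj us BJ Bfree uv; elim: uv us => {s u v} [c _|j s u v uv IH /= /andP[js us]].
  by move=> /eqP; rewrite scaler_eq0 oner_eq0 orbF => /eqP ->; rewrite scale0r.
move=> /Bfree u0; apply: big1 => i _; rewrite (IH i) ?mulr0 // u0 // => l.
apply: in_subalg_sub (twin_in_subalg BJ (uv l)) => a [j' j's ->].
by apply: contraNneq js => /Jinj <-.
Qed.
End Twin.
End Transfer.

(** * Expansion through the special forms *)

Section Spanning.
Context (K : numFieldType) (disp : Order.disp_t) (I : orderType disp) (h : K).
Local Notation H := (hAlg I h).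
Local Notation x := (hx h).
Local Notation y := (hy h).
Implicit Types (u v : H) (i j : I).

(** * Moving a letter past a word of another index *)

Section Reordering.
Variables i j : I.

(** The shape of [x j * u] and [y j * u] after the letter has been moved to the right of a word [u]
    of length [n]; the degree in each index is kept. *)
Definition passed n u := exists a b,
  [/\ word_span i n a, word_span i n b & u = a * x j + b * y j].

Lemma passed_add n u v : passed n u -> passed n v -> passed n (u + v).
Proof.
move=> [a [b [an bn ->]]] [c [d [cn dn ->]]]; exists (a + c), (b + d).
by split; rewrite ?mulrDl 1?addrACA //; apply: ws_add.
Qed.

Lemma passed_scale n c u : passed n u -> passed n (c *: u).
Proof.
move=> [a [b [an bn ->]]]; exists (c *: a), (c *: b).
by split; rewrite ?scalerDr ?scalerAl //; apply: ws_scale.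
Qed.

Lemma passed_xl n a : word_span i n a -> passed n (a * x j).
Proof. by exists a, 0; rewrite mul0r addr0; split=> //; apply: ws0. Qed.
Lemma passed_yl n a : word_span i n a -> passed n (a * y j).
Proof. by exists 0, a; rewrite mul0r add0r; split=> //; apply: ws0. Qed.

Lemma passed_y1 n u : passed n u -> passed n.+1 (u * y i).
Proof.
move=> [a [b [an bn ->]]]; rewrite mulrDl -!mulrA (xyE h j i) (yyC h j i).
rewrite mulrDr -scalerAr !mulrA; apply: passed_add; last by apply/passed_yl/ws_y.
apply: passed_add; first by apply/passed_xl/ws_y.
by apply/passed_scale/passed_yl/ws_y.
Qed.

Lemma passed_x1 n u : passed n u -> passed n.+1 (u * x i).
Proof.
move=> [a [b [an bn ->]]]; rewrite mulrDl -!mulrA (xxE h i j) (yxE h i j).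
have yn w : word_span i n w -> passed n.+1 (w * ((x i - h *: y i) * y j)).
  move=> wn; rewrite mulrA mulrBr -scalerAr; apply: passed_yl.
  by apply: ws_add; [exact: ws_x | rewrite -scaleNr; apply/ws_scale/ws_y].
apply: passed_add; last exact: yn.
rewrite !mulrDr mulrN -!scalerAr; apply: passed_add.
  apply: passed_add; rewrite mulrA; first by apply/passed_xl/ws_x.
  by apply/passed_scale/passed_xl/ws_y.
by rewrite -scaleN1r; apply/passed_scale/passed_scale/yn.
Qed.

Lemma passed_word n u : word_span i n u -> passed n (x j * u) /\ passed n (y j * u).
Proof.
elim=> {n u} [|n v _ [IHx IHy]|n v _ [IHx IHy]|n c v _ [IHx IHy]|n v w _ [IHx IHy] _ [IHx' IHy']].
- by rewrite !mulr1 -[x j]mul1r -[y j]mul1r; split; [apply: passed_xl | apply: passed_yl]; apply: ws_1.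
- by rewrite !mulrA; split; apply: passed_x1.
- by rewrite !mulrA; split; apply: passed_y1.
- by rewrite -!scalerAr; split; apply: passed_scale.
- by rewrite !mulrDr; split; apply: passed_add.
Qed.
End Reordering.

Implicit Types (s : seq I) (dg : I -> nat).

(** Combinations of products of blocks, one for each index of the list and in its order; the block
    of [i] has length [dg i]. *)
Inductive ordered_span dg : seq I -> H -> Prop :=
| os_nil c : ordered_span dg [::] c%:A
| os_cons i s u v : word_span i (dg i) u -> ordered_span dg s v ->
    ordered_span dg (i :: s) (u * v)
| os_scale s c u : ordered_span dg s u -> ordered_span dg s (c *: u)
| os_add s u v : ordered_span dg s u -> ordered_span dg s v -> ordered_span dg s (u + v).

Lemma os0 dg s : ordered_span dg s 0.
Proof.
elim: s => [|i s IH]; first by rewrite -(scale0r (1 : H)); apply: os_nil.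
by rewrite -(mulr0 0); apply: os_cons => //; apply: ws0.
Qed.

Lemma os_ext dg dg' s u : {in s, dg =1 dg'} -> ordered_span dg s u -> ordered_span dg' s u.
Proof.
move=> + us; elim: us => {s u} [c|i s u v un vs IH|s c u _ IH|s u v _ IHu _ IHv] E.
- exact: os_nil.
- apply: os_cons; first by rewrite -E ?mem_head.
  by apply: IH => j js; apply: E; rewrite inE js orbT.
- by apply: os_scale; apply: IH.
- by apply: os_add; [apply: IHu | apply: IHv].
Qed.

(** The letter is carried past the blocks in front by [passed_word] and absorbed by the block of
    [j]. *)
Lemma os_letter dg dg' j s u : j \in s -> uniq s ->
  dg' j = (dg j).+1 -> (forall i, i != j -> dg' i = dg i) ->
  ordered_span dg s u -> ordered_span dg' s (x j * u) /\ ordered_span dg' s (y j * u).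
Proof.
move=> js us dj di us'; elim: us' js us => {s u}
    [c|i s u v un vs IH|s c u _ IH|s u v _ IHu _ IHv] //=.
- rewrite inE => + /andP[is_ us]; case: eqVneq => [ji _|ji /= js].
    rewrite -ji in un is_ *; rewrite !mulrA.
    have vs' : ordered_span dg' s v.
      by apply: os_ext vs => l ls; rewrite di //; apply: contraNneq is_ => <-.
    split; apply: os_cons => //; rewrite dj -add1n; apply: ws_mul => //.
      exact: ws_x1.
    exact: ws_y1.
  have [xv yv] := IH js us.
  have E a b w : word_span i (dg i) a -> word_span i (dg i) b ->
      w = a * x j + b * y j -> ordered_span dg' (i :: s) (w * v).
    rewrite -(di i) 1?eq_sym // => an bn ->; rewrite mulrDl -!mulrA.
    by apply: os_add; apply: os_cons.
  have [[a [b [an bn ab]]] [a' [b' [an' bn' ab']]]] := passed_word j un.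
  by rewrite !mulrA; split; [apply: E ab | apply: E ab'].
- by move=> js us; have [] := IH js us; rewrite -!scalerAr; split; apply: os_scale.
- move=> js us; have [? ?] := IHu js us; have [? ?] := IHv js us.
  by rewrite !mulrDr; split; apply: os_add.
Qed.

Definition letter (g : I * bool) : H := if g.2 then y g.1 else x g.1.
Definition word (w : seq (I * bool)) : H := \prod_(g <- w) letter g.
Definition degree (w : seq (I * bool)) i := count (fun g => g.1 == i) w.

Lemma os_word s w : uniq s -> {in w, forall g, g.1 \in s} ->
  ordered_span (degree w) s (word w).
Proof.
move=> us; elim: w => [|g w IH] ws.
  rewrite /word big_nil; elim: s us {ws} => [|i s IHs] /= us.
    by rewrite -[1]scale1r; apply: os_nil.
  rewrite -[1]mul1r; apply: os_cons; first exact: ws_1.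
  by apply: IHs; case/andP: us.
have {}IH : ordered_span (degree w) s (word w).
  by apply: IH => g' g'w; apply: ws; rewrite inE g'w orbT.
have [||xw yw] := os_letter (dg' := degree (g :: w)) (ws g (mem_head _ _)) us _ _ IH.
- by rewrite /degree /= eqxx.
- by move=> i; rewrite /degree /= eq_sym => /negPf ->.
by rewrite /word big_cons /letter; case: g.2.
Qed.

Lemma in_subalg_words s u : in_subalg (fun i => i \in s) u ->
  exists2 r : seq (K * seq (I * bool)),
    {in r, forall p, {in p.2, forall g, g.1 \in s}} & u = \sum_(p <- r) p.1 *: word p.2.
Proof.
elim=> {u} [i si|i si||c u _ [r rs ->]|u v _ [r rs ->] _ [r' rs' ->]
           |u v _ [r rs ->] _ [r' rs' ->]].
- exists [:: (1, [:: (i, false)])]; last by rewrite /word !big_seq1 scale1r.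
  by move=> p /[!inE]/eqP -> g /[!inE]/eqP ->.
- exists [:: (1, [:: (i, true)])]; last by rewrite /word !big_seq1 scale1r.
  by move=> p /[!inE]/eqP -> g /[!inE]/eqP ->.
- exists [:: (1, [::])]; last by rewrite /word big_seq1 big_nil scale1r.
  by move=> p /[!inE]/eqP ->.
- exists [seq (c * p.1, p.2) | p <- r].
    by move=> _ /mapP[p /rs pr ->].
  by rewrite big_map scaler_sumr; apply: eq_bigr => p _; rewrite scalerA.
- exists (r ++ r'); last by rewrite big_cat.
  by move=> p; rewrite mem_cat => /orP[/rs|/rs'].
- exists [seq (p.1 * q.1, p.2 ++ q.2) | p <- r, q <- r'].
    move=> _ /allpairsP[[p q] [/rs pr /rs' qr ->]] g /=.
    by rewrite mem_cat => /orP[/pr|/qr].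
  rewrite big_allpairs_dep mulr_suml; apply: eq_bigr => p _.
  rewrite mulr_sumr; apply: eq_bigr => q _.
  by rewrite /word big_cat -scalerA -!scalerAl -scalerAr.
Qed.

Lemma euler_word j w : euler j (word w) = (degree w j)%:R *: word w.
Proof.
rewrite /word; elim: w => [|g w IH].
  by rewrite big_nil euler_1 scale0r.
rewrite big_cons eulerM IH -scalerAr.
have -> : euler j (letter g) = (g.1 == j)%:R *: letter g.
  by rewrite /letter; case: g.2; rewrite ?euler_x ?euler_y.
by rewrite -scalerAl -scalerDl -natrD.
Qed.

Lemma euler_homogeneous j n u : homogeneous j n u -> euler j u = n%:R *: u.
Proof.
move=> [r [rn ->]]; rewrite linear_sum scaler_sumr big_seq [RHS]big_seq.
apply: eq_bigr => p pr; rewrite linearZ /= -/(word p.2) euler_word.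
by rewrite /degree rn // !scalerA mulrC.
Qed.

(** The product of the operators [D - m], over the eigenvalues [m] other than [n], kills the
    unwanted terms and multiplies the others, and the whole sum, by the same nonzero scalar. *)
Lemma sum_eigen (D : {linear H -> H}) (T : eqType) (r : seq T) (e : T -> nat) (v : T -> H) n :
  (forall t, D (v t) = (e t)%:R *: v t) ->
  D (\sum_(t <- r) v t) = n%:R *: \sum_(t <- r) v t ->
  \sum_(t <- r) v t = \sum_(t <- r | e t == n) v t.
Proof.
move=> Dv DS; pose ms := [seq e t | t <- r & e t != n].
pose P := foldr (fun m (f : H -> H) u => D (f u) - m%:R *: f u) id.
pose c m := \prod_(a <- ms) (m%:R - a%:R) : K.
have PE l m u : D u = m%:R *: u -> P l u = \prod_(a <- l) (m%:R - a%:R) *: u.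
  move=> Du; elim: l => [|a l IH]; first by rewrite big_nil scale1r.
  rewrite big_cons /= IH linearZ /= Du !scalerA -scalerBl mulrBl.
  by rewrite [_ * m%:R]mulrC.
have Psum l : P l (\sum_(t <- r) v t) = \sum_(t <- r) P l (v t).
  by elim: l => // a l IH; rewrite /= IH linear_sum scaler_sumr -sumrB.
have cn0 : c n != 0.
  rewrite prodf_seq_neq0; apply/allP => m /mapP[t + ->]; rewrite mem_filter => /andP[tn _].
  by rewrite subr_eq0 eqr_nat eq_sym.
apply: (scalerI cn0); rewrite -(PE ms n _ DS) Psum scaler_sumr [RHS]big_mkcond.
rewrite [LHS]big_seq [RHS]big_seq; apply: eq_bigr => t tr; rewrite (PE _ _ _ (Dv t)).
case: eqP => [->//|/eqP tn].
rewrite (_ : \prod_(_ <- _) _ = 0) ?scale0r //; apply/eqP.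
rewrite prodf_seq_eq0; apply/hasP; exists (e t); last by rewrite subrr eqxx.
by apply/mapP; exists t; rewrite // mem_filter tn.
Qed.

Lemma os_homogeneous s n u : uniq s -> in_subalg (fun i => i \in s) u ->
  {in s, forall i, homogeneous i n u} -> ordered_span (fun=> n) s u.
Proof.
move=> us /in_subalg_words[r rs uE] un.
have {}uE : u = \sum_(p <- r | all (fun i => degree p.2 i == n) s) p.1 *: word p.2.
  (* An expansion into words may contain words of wrong degree; these are discarded one index at a
     time with the Euler operators. *)
  elim: (s) un => [|i s' IH] un //=.
  have {}IH : u = \sum_(p <- r | all (fun i => degree p.2 i == n) s') p.1 *: word p.2.
    by apply: IH => j js; apply: un; rewrite inE js orbT.
  rewrite {1}IH -[LHS]big_filter (sum_eigen (D := euler i) (e := fun p => degree p.2 i) (n := n)).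
  - rewrite big_filter_cond; apply: eq_bigl => p; exact: andbC.
  - by move=> p; rewrite linearZ /= euler_word !scalerA mulrC.
  - by rewrite big_filter -IH; apply/euler_homogeneous/un/mem_head.
rewrite uE big_seq_cond; elim/big_rec: _ => [|p v /andP[pr /allP pn] vs].
  exact: os0.
apply: os_add => //; apply: os_scale; apply: os_ext (os_word us (rs p pr)) => i si.
exact/eqP/pn.
Qed.

Lemma os_spanned k n (J : 'I_k -> I) (B : 'I_k -> 'I_n.+1 -> H) (s : seq 'I_k) u :
  (forall (j : 'I_k) v, word_span (J j) n v -> spanned (B j) v) -> uniq s ->
  ordered_span (fun=> n) (map J s) u ->
  spanned (fun m : {ffun 'I_k -> 'I_n.+1} => \prod_(j <- s) B j (m j)) u.
Proof.
move=> Bspan + us; move: {-2}(map J s) (erefl (map J s)) us => s' s'E us.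
elim: us s s'E => {s' u} [c|i s' u v un _ IH|s' c u _ IH|s' u v _ IHu _ IHv] s sE us.
- case: s sE us => // _ _; apply: spanned_scale.
  have := spanned_gen (fun m : {ffun 'I_k -> 'I_n.+1} => \prod_(j <- [::]) B j (m j)) [ffun=> ord0].
  by rewrite big_nil.
- case: s sE us => // j s [ij sE] /= /andP[js us].
  rewrite ij in un; have [c ->] := Bspan _ _ un; have [d ->] := IH s sE us.
  rewrite mulr_suml; apply: spanned_sum => l _; rewrite mulr_sumr.
  apply: spanned_sum => m _; rewrite -scalerAl -scalerAr; do 2!apply: spanned_scale.
  (* The multi-index takes the value [l] at [j] and agrees with [m] on [s], since [j] does not occur
     in [s]. *)
  have := spanned_gen (fun m : {ffun 'I_k -> 'I_n.+1} => \prod_(j <- j :: s) B j (m j))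
    [ffun a => if a == j then l else m a].
  rewrite /= big_cons ffunE eqxx (eq_big_seq (fun a => B a (m a))) // => a sa.
  by rewrite ffunE; case: eqP => // aj; rewrite -aj sa in js.
- exact/spanned_scale/IH.
- by apply: spanned_add; [apply: IHu | apply: IHv].
Qed.
End Spanning.

(** * Products of the coefficients of the special forms *)

Section SpecialFormProducts.
Context (K : numFieldType) (disp : Order.disp_t) (I : orderType disp) (h : K).
Variables (k n : nat) (o : I) (J : 'I_k -> I) (As : 'I_k -> 'I_n.+1 -> hAlg I h).
Hypotheses (Jinj : injective J) (Jo : forall j, J j != o).
Hypothesis Aexp : forall j, form_expansion o (As j) (bracket h o (J j) ^+ n).

Let As_J j i : in_subalg (fun a => a = J j) (As j i).
Proof. exact: ws_in_subalg (ws_special (Jo j) (Aexp j) i). Qed.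

Let As_free : free_family J As.
Proof. by move=> j u uJ; apply: special_free (Aexp j) _ uJ. Qed.

Lemma multilinear_special_transfer (C : 'I_k -> 'I_n.+1 -> hAlg I h) c :
  multilinear_expr c As = 0 -> multilinear_expr c C = 0.
Proof.
exact: (twin_eq0 Jinj (index_enum_uniq _) As_J As_free (twin_multilinear As C c)).
Qed.

(* Transfer to the scalars [C j i = (i == m j)] isolates the coefficient [c m]. *)
Lemma multilinear_special_inj (c : {ffun {ffun 'I_k -> 'I_n.+1} -> K}) : multilinear_expr c As = 0 -> c = 0.
Proof.
move=> c0; apply/ffunP => m; rewrite ffunE; apply/eqP.
have := multilinear_special_transfer (fun j i => (i == m j)%:R) c0.
rewrite /multilinear_expr (bigD1 m) //= [X in _ + X]big1 => [|m' m'm].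
  rewrite addr0 big1 => [/eqP|j _]; last by rewrite eqxx.
  by rewrite scaler_eq0 oner_eq0 orbF.
have /existsP[j mj] : [exists j, m' j != m j].
  apply: contraNT m'm => /existsPn m'E; apply/eqP/ffunP => j.
  by apply/eqP; rewrite -[_ == _]negbK; apply: m'E.
suff P0 (s : seq 'I_k) : j \in s -> \prod_(a <- s) ((m' a == m a)%:R : hAlg I h) = 0.
  by rewrite P0 ?scaler0 // mem_index_enum.
elim: s => // a s IH; rewrite inE big_cons => /orP[/eqP <-|/IH ->]; last exact: mulr0.
by rewrite (negPf mj) mul0r.
Qed.

(** Reordering writes [d] through blocks of length [n], one per index, and each block is a
    combination of the coefficients of its special form. *)
Lemma multilinear_special_exists d :
  in_subalg (fun i => exists j, i = J j) d -> (forall j, homogeneous (J j) n d) ->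
  exists c, d = multilinear_expr c As.
Proof.
move=> dJ dn; have us : uniq (map J (index_enum 'I_k)).
  by rewrite map_inj_uniq // index_enum_uniq.
have sd : in_subalg (fun i => i \in map J (index_enum 'I_k)) d.
  by apply: in_subalg_sub dJ => _ [j ->]; apply: map_f; rewrite mem_index_enum.
have hd : {in map J (index_enum 'I_k), forall i, homogeneous i n d}.
  by move=> _ /mapP[j _ ->].
have Asp j u := special_spans (Jo j) (Aexp j) (u := u).
have [c ->] := os_spanned Asp (index_enum_uniq _) (os_homogeneous us sd hd).
by exists (finfun c); apply: eq_bigr => m _; rewrite ffunE.
Qed.

(** All special forms and [f] are invariant [n]-forms, so each operator acts on their coefficients
    by the same matrix. It therefore sends the two combinations to twins, and [twin_eq0] carries the
    vanishing over to [A]. *)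
Lemma multilinear_special_invariant (A : 'I_n.+1 -> hAlg I h) f
    (c : {ffun {ffun 'I_k -> 'I_n.+1} -> K}) : is_form o A f ->
  is_invariant (multilinear_expr c As) -> is_invariant (multilinear_expr c (fun=> A)).
Proof.
move=> [_ f0 fA]; have Ao := fA.1; rewrite (form_expansion_bxy fA) in f0.
have AsE (D : hAlg I h -> hAlg I h) : universal o n D -> same_action As (fun=> A) D.
  move=> [e eP] j; exists (fun i l => e l i) => i; split; apply: eP => //.
    exact: (Aexp j).1.
  rewrite -(form_expansion_bxy (Aexp j)); apply/invariantX/invariant_bracket.
have AsA := twin_multilinear As (fun=> A) c.
have Asexp t := AsE _ (@universal_expF _ _ _ h o n t).
have D0 (D : {linear hAlg I h -> hAlg I h}) :
    twin As (fun=> A) (index_enum 'I_k) (D (multilinear_expr c As)) (D (multilinear_expr c (fun=> A))) ->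
    D (multilinear_expr c As) = 0 -> D (multilinear_expr c (fun=> A)) = 0.
  exact: (twin_eq0 Jinj (index_enum_uniq _) As_J As_free).
move=> [E0 F0 H0]; split.
- apply: (D0 (@opE _ _ I h)) E0.
  by apply: twin_skew => //; [exact: opE_1 | exact: opEM | apply/AsE/universal_opE].
- by apply: (D0 (@opF _ _ I h)) F0; apply: twin_opF => //; apply/AsE/universal_opF.
- apply: (D0 (@opH _ _ I h)) H0.
  by apply: twin_skew => //; [exact: opH_1 | exact: opHM | apply/AsE/universal_opH].
Qed.
End SpecialFormProducts.

Theorem theorem9 (R : realType) (h : R[i]) (disp : Order.disp_t)
    (I : orderType disp) (k n : nat) (idx : 'I_k.+1 -> I)
    (A : 'I_n.+1 -> hAlg I h) (f d : hAlg I h)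
    (As : 'I_k -> 'I_n.+1 -> hAlg I h) :
  h != 0 ->
  (forall a b : 'I_k.+1, (a < b)%N -> (idx a < idx b)%O) ->
  is_form (idx ord0) A f ->
  is_invariant d ->
  in_subalg (fun i => exists j : 'I_k, i = idx (lift ord0 j)) d ->
  (forall j : 'I_k, homogeneous (idx (lift ord0 j)) n d) ->
  (forall j : 'I_k,
     form_expansion (idx ord0) (As j)
       (bracket h (idx ord0) (idx (lift ord0 j)) ^+ n)) ->
  (exists! c : {ffun {ffun 'I_k -> 'I_n.+1} -> R[i]},
     d = multilinear_expr c As) /\
  (forall c : {ffun {ffun 'I_k -> 'I_n.+1} -> R[i]},
     d = multilinear_expr c As ->
     invariant_of_degree (idx ord0) k A (multilinear_expr c (fun=> A))).
Proof.
move=> _ idx_lt fA d_inv d_sub d_hom As_exp.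
(* [idx ord0] is the index of the form variables, and [lift ord0] runs over the other indices. *)
pose J (j : 'I_k) := idx (lift ord0 j).
have idx_inj : injective idx.
  by move=> a b ab; apply/val_inj; case: (ltngtP a b) => // /idx_lt; rewrite ab ltxx.
have Jinj : injective J by move=> a b /idx_inj/lift_inj.
have Jo j : J j != idx ord0 by rewrite (inj_eq idx_inj).
split=> [|c dE].
  have [c dE] := multilinear_special_exists Jinj Jo As_exp d_sub d_hom.
  exists c; split=> // c' dE'; apply/eqP; rewrite -subr_eq0; apply/eqP.
  (* Two expressions of [d] differ by a linear relation between the products, which must be
     trivial. *)
  apply: (multilinear_special_inj Jinj Jo As_exp); apply/eqP.
  rewrite -(subrr d) {1}dE dE' -sumrB; apply/eqP/eq_bigr => m _.
  by rewrite !ffunE scalerBl.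
split; first by exists c.
  case: fA => _ _ [Ao _]; apply: in_subalg_sum => m _; apply: sub_scale.
  by elim/big_rec: _ => [|j u _ uo]; [exact: sub_1 | apply: sub_mul].
by apply: (multilinear_special_invariant Jinj Jo As_exp fA); rewrite -dE.
Qed.
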